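(* Assume Condition 1 holds. Then for every $N\in\mathbb N$, neither $P_{1,N}$ nor $P_{2,N}$ is variance bounding (i.e. $P_{1,N}\notin\mathcal V$ and $P_{2,N}\notin\mathcal V$).
   Context: Let $\Theta$ and $\mathsf Y$ be metric spaces; $B_{r,z}$ denotes the metric ball of radius $r$ centred at $z$, $B^\complement$ the complement, and $0$ a fixed reference point of $\Theta$. Densities on $\Theta$ are with respect to a common dominating measure $\mathrm d\theta$ (e.g. Lebesgue or counting measure). Fix data $y\in\mathsf Y$, a tolerance $\epsilon>0$, a prior density $p:\Theta\to\mathbb R_+$ (possibly improper), and for each $\theta\in\Theta$ a probability density $f_\theta$ on $\mathsf Y$. Define $h(\theta)=f_\theta(B_{\epsilon,y})\in[0,1]$ and $w(x)=I(y\in B_{\epsilon,x})$ for $x\in\mathsf Y$. Assume $H=\int_\Theta p(\theta)h(\theta)\,\mathrm d\theta\in(0,\infty)$ and let $\pi(\theta)=p(\theta)h(\theta)/H$. Let $q(\theta,\cdot)$ be a proposal density for each $\theta$, and $c(\theta,\vartheta)=p(\theta)q(\theta,\vartheta)$. $P_{1,N}$ is the Markov kernel on $\Theta\times\mathsf Y^N$ which, from $(\theta,x_{1:N})$, samples $\vartheta\sim q(\theta,\cdot)$ and $z_{1:N}\sim f_\vartheta^{\otimes N}$ and moves to $(\vartheta,z_{1:N})$ with probability $1\wedge \frac{c(\vartheta,\theta)\sum_{j=1}^N w(z_j)}{c(\theta,\vartheta)\sum_{j=1}^N w(x_j)}$, otherwise stays at $(\theta,x_{1:N})$; it is reversible with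 respect to $\bar\pi(\theta,x_{1:N})\propto p(\theta)\prod_{j=1}^N f_\theta(x_j)\frac1N\sum_{j=1}^N w(x_j)$, whose $\theta$-marginal is $\pi$. $P_{2,N}$ is the Markov kernel on $\Theta$ given by $P(\theta,\mathrm d\vartheta)=q(\theta,\mathrm d\vartheta)\alpha(\theta,\vartheta)+\{1-\int_\Theta q(\theta,\mathrm d\theta')\alpha(\theta,\theta')\}\delta_\theta(\mathrm d\vartheta)$ with $$\alpha_{2,N}(\theta,\vartheta)=\int_{\mathsf Y^N}\int_{\mathsf Y^{N-1}}\Big[1\wedge\frac{c(\vartheta,\theta)\sum_{j=1}^N w(z_j)}{c(\theta,\vartheta)\{1+\sum_{j=1}^{N-1}w(x_j)\}}\Big]f_\theta^{\otimes N-1}(\mathrm dx_{1:N-1})f_\vartheta^{\otimes N}(\mathrm dz_{1:N});$$ it is reversible with respect to $\pi$. A kernel reversible w.r.t. a probability $\mu$ is variance bounding if $\sup\sigma_0(P)<1$, where $\sigma_0(P)$ is the spectrum of $P$ on $L^2_0(\mu)$ (mean-zero square-integrable functions); $\mathcal V$ denotes the class of such reversible kernels. $\mathcal Q$ is the set of proposals $q$ such that for all $\delta>0$ there exists $r\in(0,\infty)$ with $q(\theta,B^\complement_{r,\theta})<\delta$ for all $\theta\in\Theta$. Condition 1: $q\in\mathcal Q$; $\pi(B^\complement_{r,0})>0$ for all $r>0$; and $\lim_{v\to\infty}\sup_{\theta\in B^\complement_{v,0}}h(\theta)=0$. *)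

(* Defs.v *)
From mathcomp Require Import all_boot all_order all_algebra.
From mathcomp Require Import all_classical all_reals all_analysis.

Set Implicit Arguments.
Unset Strict Implicit.
Unset Printing Implicit Defensive.

Import Order.TTheory GRing.Theory Num.Theory.
Import numFieldNormedType.Exports.
Local Open Scope classical_set_scope.
Local Open Scope ring_scope.

Definition is_metric {R : realType} {T : Type} (dist : T -> T -> R) : Prop :=
  [/\ (forall x y, 0 <= dist x y),
      (forall x y, dist x y = 0 <-> x = y),
      (forall x y, dist x y = dist y x) &
      (forall x y z, dist x z <= dist x y + dist y z)].

Definition mball {R : realType} {T : Type} (dist : T -> T -> R) (r : R) (z : T)
  : set T := [set x | dist z x < r].

Definition prob_density {d} {T : measurableType d} {R : realType}
  (m : {measure set T -> \bar R}) (g : T -> R) : Prop :=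
  [/\ measurable_fun setT g, (forall x, 0 <= g x) &
      (\int[m]_x (g x)%:E = 1)%E].

(* integral over Y^n w.r.t. the n-fold product of nu, as an iterated
   integral over the coordinates (n.-tuple Y carries the product
   sigma-algebra of the library) *)
Fixpoint tint {d} {Y : measurableType d} {R : realType}
  (nu : {measure set Y -> \bar R}) (n : nat)
  : (n.-tuple Y -> \bar R) -> \bar R :=
  match n return (n.-tuple Y -> \bar R) -> \bar R with
  | 0 => fun F => F [tuple]
  | n'.+1 => fun F => (\int[nu]_x0 tint nu (fun t => F (cons_tuple x0 t)))%E
  end.

Section ABC.
Context {R : realType} {dT dY : measure_display}
  {Theta : measurableType dT} {Y : measurableType dY}.
Variables (mu : {measure set Theta -> \bar R}) (nu : {measure set Y -> \bar R}).
Variables (distY : Y -> Y -> R) (y : Y) (eps : R).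
Variables (p : Theta -> R) (f : Theta -> Y -> R) (q : Theta -> Theta -> R).

Definition hfun (theta : Theta) : R :=
  fine (\int[nu]_(x in mball distY eps y) (f theta x)%:E)%E.

Definition wfun (x : Y) : R := \1_(mball distY eps x) y.

Definition Hconst : \bar R := (\int[mu]_theta (p theta * hfun theta)%:E)%E.

Definition pidens (theta : Theta) : R := p theta * hfun theta / fine Hconst.

Definition cfun (theta vt : Theta) : R := p theta * q theta vt.

Definition prodf (n : nat) (theta : Theta) (x : n.-tuple Y) : R :=
  \prod_(j < n) f theta (tnth x j).

Definition sumw (n : nat) (x : n.-tuple Y) : R := \sum_(j < n) wfun (tnth x j).

Definition acc1 (N : nat) (theta : Theta) (x : N.-tuple Y)
  (vt : Theta) (z : N.-tuple Y) : R :=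
  Num.min 1 ((cfun vt theta * sumw z) / (cfun theta vt * sumw x)).

Definition P1 (N : nat) (g : Theta * N.-tuple Y -> R)
  (s : Theta * N.-tuple Y) : R :=
  let: (theta, x) := s in
  fine (\int[mu]_vt tint nu (fun z : N.-tuple Y =>
          (q theta vt * prodf vt z * acc1 theta x vt z * g (vt, z))%:E))%E
  + (1 - fine (\int[mu]_vt tint nu (fun z : N.-tuple Y =>
          (q theta vt * prodf vt z * acc1 theta x vt z)%:E))%E) * g (theta, x).

Definition pibar_un (N : nat) (theta : Theta) (x : N.-tuple Y) : R :=
  p theta * prodf theta x * (sumw x / N%:R).

Definition Zbar (N : nat) : \bar R :=
  (\int[mu]_theta tint nu (fun x : N.-tuple Y => (pibar_un theta x)%:E))%E.

Definition Ebar (N : nat) (g : Theta * N.-tuple Y -> R) : \bar R :=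
  (\int[mu]_theta tint nu (fun x : N.-tuple Y =>
      (g (theta, x) * (pibar_un theta x / fine (Zbar N)))%:E))%E.

Definition alpha2 (N : nat) (theta vt : Theta) : R :=
  fine (tint nu (fun z : N.-tuple Y => tint nu (fun x : N.-1.-tuple Y =>
     (Num.min 1 ((cfun vt theta * sumw z) /
                 (cfun theta vt * (1 + sumw x)))
      * prodf theta x * prodf vt z)%:E))).

Definition P2 (N : nat) (g : Theta -> R) (theta : Theta) : R :=
  fine (\int[mu]_vt (q theta vt * alpha2 N theta vt * g vt)%:E)%E
  + (1 - fine (\int[mu]_vt (q theta vt * alpha2 N theta vt)%:E)%E) * g theta.

Definition Epi (g : Theta -> R) : \bar R :=
  (\int[mu]_theta (g theta * pidens theta)%:E)%E.

End ABC.

Section Spectral.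
Context {d : measure_display} {S : measurableType d} {R : realType}.
(* E : expectation functional of the (probability) measure mu_E on S *)
Variable E : (S -> R) -> \bar R.

Definition L2 (g : S -> R) : Prop :=
  measurable_fun setT g /\ (E (fun s => (g s ^+ 2)%R) < +oo)%E.

Definition L20 (g : S -> R) : Prop := L2 g /\ E g = 0%E.

Definition L2eq (g1 g2 : S -> R) : Prop := E (fun s => (g1 s - g2 s) ^+ 2) = 0%E.

(* lam belongs to the spectrum of P on L^2_0 iff P - lam I is not a
   bijection of L^2_0 (modulo a.e. equality); for a bounded operator on a
   Banach space this is the usual notion (bounded inverse theorem) *)
Definition in_spectrum0 (P : (S -> R) -> S -> R) (lam : R) : Prop :=
  ~ ((forall g, L20 g -> exists g', L20 g' /\
          L2eq (fun s => P g' s - lam * g' s) g) /\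
     (forall g1 g2, L20 g1 -> L20 g2 ->
          L2eq (fun s => P g1 s - lam * g1 s) (fun s => P g2 s - lam * g2 s) ->
          L2eq g1 g2)).

Definition variance_bounding (P : (S -> R) -> S -> R) : Prop :=
  exists r : R, r < 1 /\ forall lam, in_spectrum0 P lam -> lam <= r.

End Spectral.

(* Main.v *)
Require Import Defs.
From HB Require Import structures.
From mathcomp Require Import all_boot all_order all_algebra.
From mathcomp Require Import ring lra.
From mathcomp Require Import all_classical all_reals all_analysis.
From mathcomp Require Import measurable_realfun.

Import Order.TTheory GRing.Theory Num.Theory.
Import numFieldNormedType.Exports.
Local Open Scope classical_set_scope.
Local Open Scope ring_scope.

(** Far from the reference point the hit probability [h] is small while the
    proposals stay local, so on the sets [A_n] of far away parameters the total
    acceptance probability of either chain tends uniformly to 0.  This forces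
    1 into the spectrum on the mean-zero functions, because [P - 1] is not onto.
    Along a subsequence put masses [w_k] on the sets [B_k = A_{phi k}] with
    [w_k] and the acceptance on [B_k] at most [16^-k], and let
    [H^2 = sum_k 4^-k / w_k 1_{B_k}], which is integrable.  If [P u - u = H - c],
    then reversibility bounds the integral of [|P u - u|] over [B_k] by
    [4^-k sqrt w_k (|u|^2 + 1)], whereas [H >= 2^-k / sqrt w_k] on [B_k] makes it at
    least [2^-k sqrt w_k - c w_k]; these are incompatible for large [k]. *)

(** * Reversible kernels with vanishing acceptance *)

(** Centred and normalized indicators of the far sets would only make 1 an approximate eigenvalue.
    Here the spectrum is defined through bijectivity of [P - lam], so that route needs the bounded
    inverse theorem. Packing the whole sequence into the single function [H] contradicts
    surjectivity directly, without operator theory. Acceptance is small because a move needs at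
    least one hit among the [N] fresh draws at the proposed [vt], an event of probability at most
    [min(1, N h(vt))]. This majorant depends neither on the auxiliary draws at the current state nor
    on the ratio of the [c] terms, so it serves both chains. Both are therefore instances of one
    abstract chain, given by a density [k] of accepted jumps in detailed balance with [rho]. The
    powers of 2, 4 and 16 are tied together. The increment over a set of mass [w] and acceptance
    [de] is of order [sqrt(de * w)], so [de <= 16^-k] produces the factor [4^-k]. The spike
    contributes [2^-k], small enough for square integrability and still large compared with
    [4^-k]. *)

Lemma sigma_finite_measure_exists {R : realType} {d} {T : measurableType d}
  (mu : {measure set T -> \bar R}) : sigma_finite setT mu ->
  exists m : {sigma_finite_measure set T -> \bar R},
   m = mu :> {measure set T -> \bar R}.
Proof.
case: mu => f [a b] smu.
pose mu := Measure.Pack (Measure.Class b).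
pose H : Measure_isSigmaFinite d T R mu := Measure_isSigmaFinite.Build d T R mu smu.
pose m : {sigma_finite_measure set T -> \bar R} := HB.pack (Measure.sort mu) H.
by exists m.
Qed.

(** Dominated convergence with [g] itself as majorant: every point leaves the sets for good, so the
    restrictions are eventually 0 there. *)
Lemma integral_vanishing_sets {R : realType} {d} {T : measurableType d}
  (mu : {measure set T -> \bar R}) (g : T -> R) (A : nat -> set T) :
  measurable_fun setT g -> (forall x, 0 <= g x) ->
  (\int[mu]_x (g x)%:E < +oo)%E ->
  (forall n, measurable (A n)) ->
  (forall x, \forall n \near \oo, ~ A n x) ->
  (\int[mu]_(x in A n) (g x)%:E @[n --> \oo] --> 0)%E.
Proof.
move=> mg g0 gfin mA vanA.
have mg' : measurable_fun [set: T] (fun x => (g x)%:E) by apply/measurable_EFinP.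
have [] := @dominated_convergence _ _ _ mu setT measurableT
   (fun n => (EFin \o g) \_ (A n)) (cst 0%E) (EFin \o g).
- move=> n; apply/(measurable_restrictT _ (mA n)).
  exact: measurable_funTS.
- exact: measurable_cst.
- apply: aeW => x _; apply: cvg_near_cst.
  near=> n; rewrite /patch ifF//.
  apply/negP; rewrite inE; near: n; exact: vanA.
- apply/integrableP; split => //.
  by under eq_integral do rewrite /= ger0_norm//.
- apply: aeW => x n _; rewrite /patch; case: ifP => _ /=.
    by rewrite ger0_norm.
  by rewrite normr0 lee_fin.
move=> _ _; rewrite integral0; apply: cvg_trans.
by apply: near_eq_cvg; apply: nearW => n /=; rewrite -integral_mkcond.
Unshelve. all: by end_near.
Qed.

(** The [n]-th term of the series for [H ^+ 2] contributes at most [4^-n] to the integral, whatever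
    the size of [w n]. Each point meets finitely many of the sets, so the series is finite
    everywhere and [fine] loses nothing. *)
Lemma L2_spike {R : realType} {d} {T : measurableType d}
  (mu : {measure set T -> \bar R}) (g : T -> R) (A : nat -> set T) (w : nat -> R) :
  measurable_fun setT g -> (forall x, 0 <= g x) ->
  (forall n, measurable (A n)) ->
  (forall x, \forall n \near \oo, ~ A n x) ->
  (forall n, 0 < w n) ->
  (forall n, \int[mu]_(x in A n) (g x)%:E <= (w n)%:E)%E ->
  exists H : T -> R, [/\ measurable_fun setT H, forall x, 0 <= H x,
    (\int[mu]_x (H x ^+ 2 * g x)%:E < +oo)%E &
    forall n x, A n x -> 2^-1 ^+ n <= Num.sqrt (w n) * H x ].
Proof.
move=> mg g0 mA vanA w0 Aw.
pose b n := (2^-1 ^+ n) ^+ 2 / w n.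
have b0 n : 0 <= b n by rewrite divr_ge0 ?sqr_ge0// ltW.
pose G x := (\sum_(n <oo) (b n * \1_(A n) x)%:E)%E.
have t0 n x : (0 <= (b n * \1_(A n) x)%:E)%E by rewrite lee_fin mulr_ge0.
have G0 x : (0 <= G x)%E by apply: nneseries_ge0.
have mG : measurable_fun setT G.
  apply: ge0_emeasurable_sum => // n _.
  apply/measurable_EFinP/measurable_funM => //.
have Gfin x : (G x < +oo)%E.
  have [N _ vN] := vanA x.
  rewrite /G (nneseries_split 0 N)//.
  rewrite [X in (_ + X)%E]eseries0; last first.
    move=> i /= Ni _; rewrite indicE memNset ?mulr0//.
    by apply: vN => /=; rewrite add0n in Ni.
  by rewrite adde0 add0n sumEFin ltry.
exists (fun x => Num.sqrt (fine (G x))); split.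
- apply: measurableT_comp; last by apply: measurableT_comp => //; exact: fine_measurable.
  apply: continuous_measurable_fun; exact: sqrt_continuous.
- by move=> x; apply: sqrtr_ge0.
- have -> : (\int[mu]_x (Num.sqrt (fine (G x)) ^+ 2 * g x)%:E =
     \int[mu]_x (\sum_(n <oo) ((b n)%:E * ((EFin \o g) \_ (A n)) x)))%E.
    apply: eq_integral => x _.
    rewrite sqr_sqrtr ?fine_ge0// EFinM fineK; last by rewrite ge0_fin_numE.
    rewrite muleC -nneseriesZl//.
    apply: eq_eseriesr => n _; rewrite patchE indicE; case: ifP => _ /=.
      by rewrite mulr1 muleC.
    by rewrite mulr0 !mule0.
  have gA0 n x : (0 <= ((EFin \o g) \_ (A n)) x)%E.
    by rewrite patchE; case: ifP => //= _; rewrite lee_fin.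
  have mgA n : measurable_fun setT ((EFin \o g) \_ (A n)).
    apply/(measurable_restrictT _ (mA n)); apply: measurable_funTS.
    exact/measurable_EFinP.
  rewrite integral_nneseries//; last 2 first.
    - by move=> n; apply: emeasurable_funM => //; exact: measurable_cst.
    - by move=> n x _; rewrite mule_ge0// lee_fin.
  apply: (@le_lt_trans _ _ (\sum_(n <oo) (4^-1 ^+ n)%:E)%E).
    apply: lee_nneseries => [n _ _|n _].
      by apply: integral_ge0 => x _; rewrite mule_ge0// lee_fin.
    rewrite ge0_integralZl_EFin// -integral_mkcond.
    apply: (@le_trans _ _ ((b n)%:E * (w n)%:E)%E).
      by apply: lee_wpmul2l; rewrite ?lee_fin//; exact: Aw.
    by rewrite -EFinM lee_fin /b mulfVK ?gt_eqF// -exprM mulnC exprM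
        expr2 -invfM -natrM.
  (* The terms are [2^-n] in disguise, written in the form of the geometric series with known
     sum. *)
  apply: (@le_lt_trans _ _ (\sum_(n <oo) (2 / (2 ^ (n + 1))%:R)%:E)%E).
    apply: lee_nneseries => [n _ _|n _]; first by rewrite lee_fin exprn_ge0.
    rewrite lee_fin addn1 expnS natrM invfM mulrA divff// mul1r natrX -exprVn.
    by rewrite lerXn2r// ?nnegrE//; lra.
  have /cvg_lim := @cvg_geometric_eseries_half R 2 0.
  by rewrite /eseries/= => ->//; rewrite ltry.
- move=> n x Anx; rewrite -sqrtrM ?(ltW (w0 n))//.
  rewrite -[leLHS]ger0_norm ?exprn_ge0 ?invr_ge0//.
  rewrite -sqrtr_sqr ler_wsqrtr//.
  rewrite mulrC -ler_pdivrMr// -/(b n).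
  rewrite -lee_fin fineK ?ge0_fin_numE//.
  have := @nneseries_lim_ge R (fun n => (b n * \1_(A n) x)%:E) xpredT 0 n.+1.
  move=> /(_ (fun _ _ _ => t0 _ _)); apply: le_trans.
  rewrite big_nat_recr//= indicE mem_set// mulr1.
  by rewrite leeDr// sume_ge0.
Qed.

Lemma measurable_uncurry_r {R : realType} {d1 d2} {S : measurableType d1}
    {T : measurableType d2} (k : S -> T -> R) (s : S) :
  measurable_fun setT (fun st : S * T => k st.1 st.2) ->
  measurable_fun setT (k s).
Proof.
by move=> mk; exact: (measurableT_comp mk (measurable_pair1 s)).
Qed.

(** * Energy estimates for the accepted jumps of a reversible chain *)

Section reversible_jump.
Context {R : realType} {dS : measure_display} {S : measurableType dS}.
Variables (m : {sigma_finite_measure set S -> \bar R}).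
Variables (rho : S -> R) (k : S -> S -> R).
Hypotheses (mrho : measurable_fun setT rho) (rho0 : forall s, 0 <= rho s).
Hypotheses (mk : measurable_fun setT (fun st : S * S => k st.1 st.2)).
Hypotheses (k0 : forall s t, 0 <= k s t).
Hypothesis k1 : forall s, (\int[m]_t (k s t)%:E <= 1)%E.
Hypothesis kC : forall s t, rho s * k s t = rho t * k t s.

Let mk1 s : measurable_fun setT (k s).
Proof. exact: measurable_uncurry_r mk. Qed.

(** Tonelli and detailed balance turn the left side into the integral of [v t * rho t] times the
    acceptance at [t], which is at most 1. For [v] a square this is the contraction property of the
    jump part. *)
Lemma reversible_energy_le (v : S -> R) :
  measurable_fun setT v -> (forall s, 0 <= v s) ->
  (\int[m]_s ((rho s)%:E * \int[m]_t (k s t * v t)%:E)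
     <= \int[m]_s (v s * rho s)%:E)%E.
Proof.
move=> mv v0.
have -> : (\int[m]_s ((rho s)%:E * \int[m]_t (k s t * v t)%:E) =
   \int[m]_s \int[m]_t (rho s * k s t * v t)%:E)%E.
  apply: eq_integral => s _; rewrite -ge0_integralZl_EFin//.
  - by apply: eq_integral => t _; rewrite -EFinM mulrA.
  - by move=> t _; rewrite lee_fin mulr_ge0.
  - by apply/measurable_EFinP/measurable_funM.
rewrite (fubini_tonelli (fun z : S * S => (rho z.1 * k z.1 z.2 * v z.2)%:E)); first last.
- by move=> z; rewrite lee_fin !mulr_ge0.
- apply/measurable_EFinP/measurable_funM; last exact: measurableT_comp.
  by apply: measurable_funM => //; exact: measurableT_comp.
apply: ge0_le_integral => //.
- by move=> t _; apply: integral_ge0 => s _; rewrite lee_fin !mulr_ge0.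
- apply: (measurable_fun_fubini_tonelli_F (fun z : S * S => (rho z.2 * k z.2 z.1 * v z.1)%:E)).
    apply/measurable_EFinP/measurable_funM; last exact: measurableT_comp.
    apply: measurable_funM; first exact: measurableT_comp.
    exact: (measurableT_comp mk (@measurable_swap _ _ S S)).
  by move=> z; rewrite lee_fin !mulr_ge0.
- by apply/measurable_EFinP/measurable_funM.
move=> t _ /=.
under eq_integral do rewrite kC mulrC mulrA EFinM.
rewrite ge0_integralZl_EFin//; last 3 first.
- by move=> s _; rewrite lee_fin.
- exact/measurable_EFinP.
- by rewrite mulr_ge0.
by rewrite -[leRHS]mule1 lee_wpmul2l// lee_fin mulr_ge0.
Qed.

(** [D] stands for [P u - u]. AM-GM splits its jump term and its staying term alike, each into
    [t / 2] times an energy and [1 / (2 t)] times the acceptance. The two energies add up to the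
    global one with factor [t]; the two acceptances, at most [de] on [B], give [de / t]. *)
Lemma low_acceptance_increment_le (B : set S) (de t : R) (u D : S -> R) :
  measurable B -> 0 < t -> 0 <= de ->
  measurable_fun setT u -> measurable_fun setT D ->
  (forall s, B s -> \int[m]_s' (k s s')%:E <= de%:E)%E ->
  (forall s, `|D s|%:E <=
     \int[m]_s' (k s s' * `|u s'|)%:E + \int[m]_s' (k s s')%:E * `|u s|%:E)%E ->
  (\int[m]_(s in B) (`|D s| * rho s)%:E <=
    t%:E * \int[m]_s (u s ^+ 2 * rho s)%:E
    + (de / t)%:E * \int[m]_(s in B) (rho s)%:E)%E.
Proof.
move=> mB t0 de0 mu mD kde bD.
(* The free parameter [t] of AM-GM plays the role of the Cauchy-Schwarz inequality. *)
have amgm (x : R) : `|x| <= t / 2 * x ^+ 2 + (2 * t)^-1.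
  rewrite -subr_ge0 (_ : _ - _ = (t * `|x| - 1) ^+ 2 / (2 * t)).
    by rewrite divr_ge0 ?sqr_ge0// mulr_ge0// ltW.
  by rewrite -(real_normK (num_real x)); field; rewrite gt_eqF.
pose a s := (\int[m]_s' (k s s')%:E)%E.
pose K2 s := (\int[m]_s' (k s s' * u s' ^+ 2)%:E)%E.
have a0 s : (0 <= a s)%E by apply: integral_ge0 => ? _; rewrite lee_fin.
have K20 s : (0 <= K2 s)%E.
  by apply: integral_ge0 => ? _; rewrite lee_fin mulr_ge0// sqr_ge0.
have mu2 : measurable_fun setT (fun s => u s ^+ 2) by exact: measurable_funX.
have mK2 : measurable_fun setT K2.
  apply: (measurable_fun_fubini_tonelli_F (fun z : S * S => (k z.1 z.2 * u z.2 ^+ 2)%:E)).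
    apply/measurable_EFinP/measurable_funM => //.
    exact: (measurableT_comp mu2).
  by move=> z; rewrite lee_fin mulr_ge0// sqr_ge0.
have t2 : 0 <= t / 2 by rewrite divr_ge0// ltW.
have t2' : 0 <= (2 * t)^-1 by rewrite invr_ge0 mulr_ge0// ltW.
have jump s : (\int[m]_s' (k s s' * `|u s'|)%:E <=
    (t / 2)%:E * K2 s + ((2 * t)^-1)%:E * a s)%E.
  rewrite /a /K2 -!ge0_integralZl_EFin//; last 4 first.
  - by move=> ? _; rewrite lee_fin.
  - exact/measurable_EFinP.
  - by move=> ? _; rewrite lee_fin mulr_ge0// sqr_ge0.
  - by apply/measurable_EFinP/measurable_funM.
  rewrite -ge0_integralD//; last 4 first.
  - by move=> ? _; rewrite -EFinM lee_fin mulr_ge0// mulr_ge0// sqr_ge0.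
  - by apply/measurable_EFinP/measurable_funM => //; apply: measurable_funM.
  - by move=> ? _; rewrite -EFinM lee_fin mulr_ge0.
  - by apply/measurable_EFinP/measurable_funM.
  apply: ge0_le_integral => //.
  - by move=> ? _; rewrite lee_fin mulr_ge0.
  - by apply/measurable_EFinP/measurable_funM => //; apply: measurableT_comp.
  - apply/measurable_EFinP/measurable_funD; apply: measurable_funM => //.
    exact: measurable_funM.
  move=> s' _; rewrite -!EFinM -EFinD lee_fin.
  apply: le_trans (ler_wpM2l (k0 s s') (amgm (u s'))) _.
  by rewrite mulrDr mulrCA [k s s' * _^-1]mulrC.
(* The energy also carries the factor [a s] here; it is bounded by 1, while the factor in the second
   term is kept. *)
have stay s : (a s * `|u s|%:E <=
    (t / 2)%:E * (u s ^+ 2)%:E + ((2 * t)^-1)%:E * a s)%E.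
  apply: (@le_trans _ _ (a s * ((t / 2) * u s ^+ 2 + (2 * t)^-1)%:E)%E).
    by apply: lee_wpmul2l; rewrite ?lee_fin.
  have q0 : 0 <= t / 2 * u s ^+ 2 by rewrite mulr_ge0// sqr_ge0.
  rewrite EFinD ge0_muleDr ?lee_fin//.
  rewrite [X in (_ <= _ + X)%E]muleC leeD2r// -EFinM.
  by rewrite -[leRHS]mul1e lee_wpmul2r//; exact: k1.
have pt s : B s -> ((`|D s| * rho s)%:E <= (t / 2)%:E * ((rho s)%:E * K2 s)
    + ((t / 2)%:E * (u s ^+ 2 * rho s)%:E + (de / t)%:E * (rho s)%:E))%E.
  move=> Bs.
  have : (`|D s|%:E <= (t / 2)%:E * K2 s +
      ((t / 2)%:E * (u s ^+ 2)%:E + (de / t)%:E))%E.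
    apply: (le_trans (bD s)); apply: (le_trans (leeD (jump s) (stay s))).
    rewrite -addeA leeD2l// addeCA leeD2l// -ge0_muleDl ?lee_fin//.
    apply: (@le_trans _ _ (((2 * t)^-1 + (2 * t)^-1)%:E * de%:E)%E).
      by apply: lee_wpmul2l; rewrite ?lee_fin ?addr_ge0//; exact: kde.
    rewrite -EFinM lee_fin le_eqVlt; apply/orP; left; apply/eqP.
    by field; rewrite gt_eqF.
  have rs : (0 <= (rho s)%:E)%E by rewrite lee_fin.
  have X0 : (0 <= (t / 2)%:E * K2 s)%E by rewrite mule_ge0// lee_fin.
  have Y0 : (0 <= (t / 2 * u s ^+ 2 + de / t)%:E)%E.
    by rewrite lee_fin addr_ge0 ?divr_ge0 ?(ltW t0)// mulr_ge0// sqr_ge0.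
  have -> : (`|D s| * rho s)%:E = ((rho s)%:E * `|D s|%:E)%E.
    by rewrite -EFinM mulrC.
  move=> /(lee_wpmul2l rs)/le_trans; apply; rewrite -!EFinM -!EFinD.
  rewrite ge0_muleDr// muleCA leeD2l// -!EFinM lee_fin.
  by rewrite le_eqVlt; apply/orP; left; apply/eqP; ring.
have mrK : measurable_fun setT (fun s => (rho s)%:E * K2 s)%E.
  by apply: emeasurable_funM => //; exact/measurable_EFinP.
have mur : measurable_fun setT (fun s => (u s ^+ 2 * rho s)%:E).
  exact/measurable_EFinP/measurable_funM.
have rK0 s : (0 <= (rho s)%:E * K2 s)%E by rewrite mule_ge0// lee_fin.
have ur0 s : (0 <= (u s ^+ 2 * rho s)%:E)%E by rewrite lee_fin mulr_ge0// sqr_ge0.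
have det0 : 0 <= de / t by rewrite divr_ge0// ltW.
apply: (@le_trans _ _ (\int[m]_(s in B) ((t / 2)%:E * ((rho s)%:E * K2 s)
    + ((t / 2)%:E * (u s ^+ 2 * rho s)%:E + (de / t)%:E * (rho s)%:E)))%E).
  apply: ge0_le_integral => //.
  - by move=> s _; rewrite lee_fin mulr_ge0.
  - apply: measurable_funTS; apply/measurable_EFinP/measurable_funM => //.
    exact: measurableT_comp.
  - apply: measurable_funTS; apply: emeasurable_funD.
      by apply: emeasurable_funM => //; exact: measurable_cst.
    apply: emeasurable_funD.
      by apply: emeasurable_funM => //; exact: measurable_cst.
    by apply/measurable_EFinP/measurable_funM.
have mrho' : measurable_fun B (fun s => (rho s)%:E).
  by apply: measurable_funTS; exact/measurable_EFinP.
rewrite ge0_integralD//; last 4 first.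
- by move=> s _; rewrite mule_ge0// lee_fin.
- apply: measurable_funTS.
  by apply: emeasurable_funM => //; exact: measurable_cst.
- by move=> s _; apply: adde_ge0; apply: mule_ge0 => //; rewrite lee_fin.
- apply: emeasurable_funD; apply: emeasurable_funM => //;
    try exact: measurable_cst; exact: measurable_funTS.
rewrite ge0_integralD//; last 4 first.
- by move=> s _; rewrite mule_ge0// lee_fin.
- apply: measurable_funTS.
  by apply: emeasurable_funM => //; exact: measurable_cst.
- by move=> s _; rewrite mule_ge0// lee_fin.
- by apply: emeasurable_funM => //; exact: measurable_cst.
rewrite !ge0_integralZl_EFin//;
  try (exact: measurable_funTS); try (by move=> s _; rewrite lee_fin).
rewrite addeA leeD2r//.
pose I := (\int[m]_s (u s ^+ 2 * rho s)%:E)%E.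
(* Jumps may leave [B], so the jump energy is controlled only by the integral over the whole space;
   both energies are enlarged to it. *)
apply: (@le_trans _ _ ((t / 2)%:E * I + (t / 2)%:E * I)%E).
  apply: leeD; apply: lee_wpmul2l; rewrite ?lee_fin//; last first.
    by apply: ge0_subset_integral => //; exact: measurableT.
  apply: (@le_trans _ _ (\int[m]_s ((rho s)%:E * K2 s))%E).
    by apply: ge0_subset_integral => //; exact: measurableT.
  by apply: (reversible_energy_le (fun s => u s ^+ 2)) => // s; exact: sqr_ge0.
have I0 : (0 <= I)%E by exact: integral_ge0.
by rewrite -ge0_muleDl ?lee_fin// -EFinD -splitr.
Qed.

End reversible_jump.

(** [phi] need not be monotone: [k <= phi k] alone ensures that a point which eventually leaves the
    original sets also eventually leaves the selected ones. *)
Lemma exists_thin_subsequence {R : realType} (x : nat -> \bar R) (Q : nat -> R -> Prop) :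
  (x n @[n --> \oo] --> 0)%E ->
  (forall e : R, 0 < e -> \forall n \near \oo, Q n e) ->
  exists phi : nat -> nat, forall k, [/\ (k <= phi k)%N,
    (x (phi k) < (16^-1 ^+ k)%:E)%E & Q (phi k) (16^-1 ^+ k)].
Proof.
move=> x0 Qe.
suff /choice[phi phiP] : forall k, exists n, [/\ (k <= n)%N,
    (x n < (16^-1 ^+ k)%:E)%E & Q n (16^-1 ^+ k)] by exists phi.
move=> k; have k0 : (0 : R) < 16^-1 ^+ k by rewrite exprn_gt0// invr_gt0.
have : \forall n \near \oo, (k <= n)%N /\ ((x n < (16^-1 ^+ k)%:E)%E /\ Q n (16^-1 ^+ k)).
  near=> n; split; first by near: n; exact: nbhs_infty_ge.
  split; last by near: n; exact: Qe.
  near: n; have /fine_cvgP[xfin xc] := x0.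
  move/cvgrPdist_lt : xc => /(_ _ k0) xc.
  near=> n.
  have xnf : x n \is a fin_num by near: n; exact: xfin.
  rewrite -(fineK xnf) lte_fin; apply: le_lt_trans (ler_norm _) _.
  rewrite -normrN -sub0r; near: n; exact: xc.
by move=> /filter_ex[n [? [? ?]]]; exists n.
Unshelve. all: by end_near.
Qed.

(** [pr] extracts the parameter from a state. The functional [E] is tied to [m] only on nonnegative
    functions, where Tonelli identifies iterated and single integrals. Signed expectations are
    needed only for the spike, a function of the parameter, and are computed on [T] with the
    marginal density [g]. *)
Lemma not_variance_bounding_of_low_acceptance {R : realType}
  {dS dT} {S : measurableType dS} {T : measurableType dT}
  (m : {sigma_finite_measure set S -> \bar R}) (mu : {measure set T -> \bar R})
  (rho : S -> R) (k : S -> S -> R) (pr : S -> T) (g : T -> R)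
  (E : (S -> R) -> \bar R) (P : (S -> R) -> (S -> R)) (A : nat -> set T) :
  measurable_fun setT rho -> (forall s, 0 <= rho s) ->
  measurable_fun setT (fun st : S * S => k st.1 st.2) ->
  (forall s t, 0 <= k s t) ->
  (forall s, \int[m]_t (k s t)%:E <= 1)%E ->
  (forall s t, rho s * k s t = rho t * k t s) ->
  measurable_fun setT pr ->
  measurable_fun setT g -> (forall x, 0 <= g x) -> (\int[mu]_x (g x)%:E = 1)%E ->
  (forall u : S -> R, measurable_fun setT u -> (forall s, (0 <= u s)%R) ->
     E u = \int[m]_s (u s * rho s)%:E)%E ->
  (forall v : T -> R, measurable_fun setT v ->
     E (v \o pr) = \int[mu]_x (v x * g x)%:E)%E ->
  (forall u : S -> R, measurable_fun setT u -> measurable_fun setT (P u)) ->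
  (forall (u : S -> R) s, measurable_fun setT u -> `|P u s - u s|%R%:E <=
     \int[m]_t (k s t * `|u t|)%:E + \int[m]_t (k s t)%:E * `|u s|%:E)%E ->
  (forall n, measurable (A n)) ->
  (forall x, \forall n \near \oo, ~ A n x) ->
  (forall n, 0 < \int[mu]_(x in A n) (g x)%:E)%E ->
  (forall e : R, (0 < e)%R -> \forall n \near \oo,
     forall s, A n (pr s) -> \int[m]_t (k s t)%:E <= e%:E)%E ->
  ~ variance_bounding E P.
Proof.
move=> mrho rho0 mk k0 k1 kC mpr mg g0 g1 Em Emu mP dP mA vanA A0 lowA.
have mg' : measurable_fun setT (fun x => (g x)%:E) by exact/measurable_EFinP.
have gfin : (\int[mu]_x (g x)%:E < +oo)%E by rewrite g1 ltry.
have Aw := integral_vanishing_sets mu g A mg g0 gfin mA vanA.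
have [phi phiP] := exists_thin_subsequence _ _ Aw lowA.
pose B n := A (phi n).
pose w n := fine (\int[mu]_(x in B n) (g x)%:E)%E.
have wfin n : (w n)%:E = (\int[mu]_(x in B n) (g x)%:E)%E.
  rewrite /w fineK// ge0_fin_numE; last by apply: integral_ge0 => x _; rewrite lee_fin.
  by have [_ /lt_trans-> //] := phiP n; rewrite ltry.
have w0 n : 0 < w n by rewrite -lte_fin wfin; exact: A0.
have wle n : w n <= 16^-1 ^+ n.
  by rewrite -lee_fin wfin; have [_ /ltW] := phiP n.
have mB n : measurable (B n) by exact: mA.
have vanB x : \forall n \near \oo, ~ B n x.
  have [N _ vN] := vanA x; exists N => // n /= Nn; apply: vN => /=.
  by have [+ _ _] := phiP n; exact: leq_trans.
have wle' n : (\int[mu]_(x in B n) (g x)%:E <= (w n)%:E)%E by rewrite wfin.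
have [H [mH H0 H2 HB]] := L2_spike mu g B w mg g0 mB vanB w0 wle'.
have mHg : measurable_fun setT (fun x => H x * g x) by exact: measurable_funM.
have mH2g : measurable_fun setT (fun x => H x ^+ 2 * g x).
  by apply: measurable_funM => //; exact: measurable_funX.
have ig : mu.-integrable setT (fun x => (g x)%:E).
  apply/integrableP; split => //.
  under eq_integral do rewrite /= ger0_norm//.
  by rewrite g1 ltry.
have iH2 : mu.-integrable setT (fun x => (H x ^+ 2 * g x)%:E).
  apply/integrableP; split; first exact/measurable_EFinP.
  by under eq_integral do rewrite /= ger0_norm ?mulr_ge0 ?sqr_ge0//.
(* [H <= 1 + H ^+ 2], and [g] has mass 1. *)
have iH : mu.-integrable setT (fun x => (H x * g x)%:E).
  apply: (le_integrable measurableT _ _ (integrableD measurableT ig iH2)).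
    exact/measurable_EFinP.
  move=> x _; rewrite -EFinD !abse_EFin lee_fin ger0_norm ?mulr_ge0//.
  rewrite ger0_norm ?addr_ge0 ?mulr_ge0 ?sqr_ge0//.
  rewrite -[X in X + _]mul1r -mulrDl ler_wpM2r//.
  have := sqr_ge0 (H x - 1); have := H0 x; nra.
pose c := fine (\int[mu]_x (H x * g x)%:E)%E.
have cE : c%:E = (\int[mu]_x (H x * g x)%:E)%E by rewrite /c fineK// integrable_fin_num.
have c0 : 0 <= c by apply: fine_ge0; apply: integral_ge0 => x _; rewrite lee_fin mulr_ge0.
pose h (s : S) := H (pr s) - c.
have hE : h = (fun x => H x - c) \o pr by [].
have mHc : measurable_fun setT (fun x => H x - c) by exact: measurable_funB.
have mh : measurable_fun setT h by rewrite hE; exact: measurableT_comp.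
have h20 : L20 E h.
  split; first split => //.
    rewrite (_ : (fun _ => _) = (fun x => (H x - c) ^+ 2) \o pr)// Emu; last first.
      exact: measurable_funX.
    apply: (@le_lt_trans _ _ (\int[mu]_x (2%:E * (H x ^+ 2 * g x)%:E
        + (2 * c ^+ 2)%:E * (g x)%:E))%E).
      apply: ge0_le_integral => //.
      - by move=> x _; rewrite lee_fin mulr_ge0// sqr_ge0.
      - by apply/measurable_EFinP/measurable_funM => //; exact: measurable_funX.
      - apply: emeasurable_funD; apply: emeasurable_funM => //; exact/measurable_EFinP.
      move=> x _; rewrite -!EFinM -EFinD lee_fin mulrA -mulrDl ler_wpM2r//.
      by have := sqr_ge0 (H x + c); nra.
    rewrite integralD//; try exact: integrableZl.
    by rewrite !integralZl// g1 mule1 lte_add_pinfty ?ltry// lte_mul_pinfty ?lee_fin.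
  rewrite hE Emu//.
  under eq_integral do rewrite mulrBl EFinB EFinM -EFinM [(c * _)%:E]EFinM.
  rewrite integralB//; last exact: integrableZl.
  by rewrite integralZl// g1 mule1 -cE -EFinB subrr.
case=> r [r1 specr].
(* Since [r < 1], the value 1 lies outside the spectrum, so [P - 1] reaches the centred spike [h];
   [u] below is a preimage. *)
have /contrapT[surj _] : ~ in_spectrum0 E P 1 by move=> /specr; rewrite leNgt r1.
have [u [[[mu' u2] _] Eu]] := surj _ h20.
have mPu := mP _ mu'.
have mD : measurable_fun setT (fun s => P u s - u s) by exact: measurable_funB.
pose U := fine (\int[m]_s (u s ^+ 2 * rho s)%:E)%E.
have u20 s : 0 <= u s ^+ 2 * rho s by rewrite mulr_ge0// sqr_ge0.
have UE : U%:E = (\int[m]_s (u s ^+ 2 * rho s)%:E)%E.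
  rewrite /U fineK// ge0_fin_numE; last by apply: integral_ge0 => s _; rewrite lee_fin.
  rewrite -Em//; first exact: measurable_funX.
  by move=> s; exact: sqr_ge0.
(* The equation for [u] holds in the [L2] sense, that is, up to sets of zero [rho]-weight. Keeping
   the factor [rho] makes it a statement almost everywhere for [m]. *)
have ae_h : {ae m, forall s, `|P u s - u s| * rho s = `|h s| * rho s}.
  pose e s := (P u s - 1 * u s - h s) ^+ 2.
  have me : measurable_fun setT e.
    apply: measurable_funX; apply: measurable_funB => //.
    by apply: measurable_funB => //; exact: measurable_funM.
  have e0 s : 0 <= e s by exact: sqr_ge0.
  have : (\int[m]_s `|(e s * rho s)%:E| = 0)%E.
    transitivity (\int[m]_s (e s * rho s)%:E)%E; last by rewrite -Em.
    by apply: eq_integral => s _; rewrite gee0_abs// lee_fin mulr_ge0.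
  move/ae_eq_integral_abs => /(_ measurableT) ae_e.
  have /ae_e : measurable_fun setT (fun s => (e s * rho s)%:E).
    by apply/measurable_EFinP/measurable_funM.
  apply: filterS => s /(_ I) [] /eqP.
  rewrite mulf_eq0 => /orP[|/eqP->]; last by rewrite !mulr0.
  by rewrite sqrf_eq0 mul1r subr_eq0 => /eqP ->.
have piB n : (\int[m]_(s in pr @^-1` B n) (rho s)%:E = (w n)%:E)%E.
  rewrite wfin [LHS]integral_mkcond [RHS]integral_mkcond.
  transitivity (E (\1_(B n) \o pr)).
    rewrite Em//; last first.
      exact: measurableT_comp.
    apply: eq_integral => s _; rewrite patchE /= indicE.
    rewrite (_ : (s \in pr @^-1` B n) = (pr s \in B n)); last first.
      by apply/idP/idP; rewrite !inE.
    by case: ifP; rewrite ?mul1r ?mul0r.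
  rewrite Emu//; apply: eq_integral => x _; rewrite patchE /= indicE.
  by case: ifP; rewrite ?mul1r ?mul0r.
have mprB n : measurable (pr @^-1` B n).
  by rewrite -[X in measurable X]setTI; exact: mpr.
(* With [v = sqrt (w n)], the increment estimate is applied with [t = 4^-n * v]: for [de = 16^-n]
   its two terms become [4^-n * v * U] and [4^-n * v]. Dividing by [v] leaves [2^-n - c * v] on the
   other side, and [v <= 4^-n] absorbs the centring. *)
have key n : 2^-1 ^+ n <= 4^-1 ^+ n * (U + 1 + c).
  pose v := Num.sqrt (w n); have v0 : 0 < v by rewrite sqrtr_gt0.
  have vv : w n = v * v by rewrite -expr2 sqr_sqrtr// ltW.
  have f0 : (0 : R) < 4^-1 ^+ n by rewrite exprn_gt0// invr_gt0.
  have ff : 16^-1 ^+ n = 4^-1 ^+ n * 4^-1 ^+ n :> R.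
    by rewrite -exprMn -invfM -natrM.
  have vle : v <= 4^-1 ^+ n.
    by rewrite -[leRHS]ger0_norm ?(ltW f0)// -sqrtr_sqr ler_wsqrtr// expr2 -ff.
  have t0 : 0 < 4^-1 ^+ n * v by rewrite mulr_gt0.
  have d0 : 0 <= (16^-1 : R) ^+ n by rewrite exprn_ge0// invr_ge0.
  have low s : (pr @^-1` B n) s -> (\int[m]_t (k s t)%:E <= (16^-1 ^+ n)%:E)%E.
    by have [_ _] := phiP n; apply.
  have := low_acceptance_increment_le m rho k mrho rho0 mk k0 k1 kC _ _ _ u
    (fun s => P u s - u s) (mprB n) t0 d0 mu' mD low (fun s => dP u s mu').
  rewrite -UE piB -!EFinM -EFinD.
  have -> : 4^-1 ^+ n * v * U + 16^-1 ^+ n / (4^-1 ^+ n * v) * w n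
      = 4^-1 ^+ n * (U + 1) * v :> R.
    by rewrite ff vv; field; rewrite !gt_eqF.
  move=> ub.
  have lb : (((2^-1 ^+ n - c * v) * v)%:E <=
      \int[m]_(s in pr @^-1` B n) (`|P u s - u s| * rho s)%:E)%E.
    have -> : ((2^-1 ^+ n - c * v) * v = (2^-1 ^+ n / v - c) * w n)%R.
      by rewrite vv; field; rewrite gt_eqF.
    set q := _ - c; have qh s : B n (pr s) -> q <= `|h s|.
      move=> /(HB n); rewrite -/v mulrC -ler_pdivrMr// => qs.
      by apply: le_trans (ler_norm _); rewrite lerD2r.
    have [q0|q0] := leP 0 q; last first.
      apply: (@le_trans _ _ 0%E); first by rewrite lee_fin mulr_le0_ge0// ltW.
      by apply: integral_ge0 => s _; rewrite lee_fin mulr_ge0.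
    rewrite EFinM -piB -ge0_integralZl_EFin//.
    - apply: ae_ge0_le_integral => //.
      + by move=> s _; rewrite -EFinM lee_fin mulr_ge0.
      + apply: measurable_funTS; apply/measurable_EFinP.
        exact: measurable_funM.
      + by move=> s _; rewrite lee_fin mulr_ge0.
      + apply: measurable_funTS; apply/measurable_EFinP.
        by apply: measurable_funM => //; exact: measurableT_comp.
      apply: filterS ae_h => s -> Bs; rewrite -EFinM lee_fin ler_wpM2r//.
      exact: qh.
    - by move=> s _; rewrite lee_fin.
    - by apply: measurable_funTS; exact/measurable_EFinP.
  have := le_trans lb ub; rewrite lee_fin ler_pM2r//.
  rewrite lerBlDr => /le_trans; apply.
  rewrite [leRHS]mulrDr lerD2l mulrC ler_wpM2r//.
(* Multiplied by [4^n], [key] reads [2^n <= U + 1 + c], which fails for large [n]. *)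
have [n nb] : exists n, U + 1 + c < 2 ^+ n.
  exists (Num.truncn (U + 1 + c)).+1.
  apply: (lt_le_trans (truncnS_gt _)).
  by rewrite -natrX ler_nat ltnW// ltn_expl.
have := key n.
rewrite leNgt => /negP; apply.
rewrite (_ : 4^-1 = 2^-1 * 2^-1 :> R); last by rewrite -invfM -natrM.
rewrite exprMn -mulrA gtr_pMr ?exprn_gt0 ?invr_gt0//.
by rewrite exprVn mulrC ltr_pdivrMr ?exprn_gt0// mul1r.
Qed.

(** * Iterated integrals over tuples *)

(** Tonelli covers nonnegative integrands; positive and negative parts extend it to any sign without
    integrability. This is what makes [P u] measurable for every measurable [u]. *)
Lemma measurable_integral_param {R : realType} {d1 d2} {T1 : measurableType d1}
  {T2 : measurableType d2} (m2 : {sigma_finite_measure set T2 -> \bar R})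
  (F : T1 * T2 -> \bar R) : measurable_fun setT F ->
  measurable_fun setT (fun x => \int[m2]_y F (x, y))%E.
Proof.
move=> mF.
rewrite (_ : (fun x => _) = fun x => (\int[m2]_y (F^\+ (x, y)) - \int[m2]_y (F^\- (x, y)))%E).
  apply: emeasurable_funB.
    apply: (measurable_fun_fubini_tonelli_F (F^\+)%E) => //.
    exact: measurable_funepos.
  apply: (measurable_fun_fubini_tonelli_F (F^\-)%E) => //.
  exact: measurable_funeneg.
apply/funext => x; rewrite [LHS]integralE.
by congr (_ - _)%E; apply: eq_integral => y _; rewrite ?funeposE ?funenegE.
Qed.

Lemma product_measure_exists {R : realType} {d1 d2} {T1 : measurableType d1}
  {T2 : measurableType d2} (m1 : {sigma_finite_measure set T1 -> \bar R})
  (m2 : {sigma_finite_measure set T2 -> \bar R}) :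
  exists m : {sigma_finite_measure set (T1 * T2)%type -> \bar R},
  forall F : T1 * T2 -> \bar R, measurable_fun setT F -> (forall z, 0 <= F z)%E ->
    (\int[m]_z F z = \int[m1]_x \int[m2]_y F (x, y))%E.
Proof.
have /sigma_finite_measure_exists[m mE] :
    sigma_finite setT (m1 \x m2 : {measure set (T1 * T2)%type -> \bar R})%E.
  have [F TF Ffin] := sigma_finiteT m1; have [G TG Gfin] := sigma_finiteT m2.
  (* Rectangles of the two covers, enumerated through the coding of pairs; an index that codes no
     pair gets the empty set. *)
  pose FG n := if unpickle n is Some (i, j) then F i `*` G j else set0.
  exists FG.
    apply/esym; rewrite -subTset => -[x y] _.
    have [i _ Fix] : (\bigcup_i F i) x by rewrite -TF.
    have [j _ Gjy] : (\bigcup_j G j) y by rewrite -TG.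
    by exists (pickle (i, j)) => //; rewrite /FG pickleK.
  move=> n; rewrite /FG; case: unpickle => [[i j]|]; last by rewrite measure0.
  have [mFi Fioo] := Ffin i; have [mGj Gjoo] := Gfin j.
  split; first exact: measurableX.
  by rewrite /= product_measure1E// lte_mul_pinfty// ge0_fin_numE.
exists m => F mF F0.
by move: (congr1 (@Measure.sort _ _ _) mE) => /= ->; rewrite fubini_tonelli1.
Qed.

Lemma sigma_finite_image_exists {R : realType} {d1 d2} {T1 : measurableType d1}
  {T2 : measurableType d2} (m : {sigma_finite_measure set T1 -> \bar R})
  (phi : T1 -> T2) (psi : T2 -> T1) :
  measurable_fun setT phi -> measurable_fun setT psi -> cancel phi psi ->
  exists m' : {sigma_finite_measure set T2 -> \bar R},
  forall F : T2 -> \bar R, measurable_fun setT F -> (forall z, 0 <= F z)%E ->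
    (\int[m']_z F z = \int[m]_x F (phi x))%E.
Proof.
move=> mphi mpsi phiK.
pose mm : {measure set T2 -> \bar R} :=
  measure_function_pushforward__canonical__measure_function_Measure m mphi.
have /sigma_finite_measure_exists[m' m'E] : sigma_finite setT mm.
  have [F TF Ffin] := sigma_finiteT m.
  exists (fun i => psi @^-1` F i).
    by rewrite -preimage_bigcup -TF preimage_setT.
  move=> i; have [mFi mFoo] := Ffin i; split.
    by rewrite -[X in measurable X]setTI; exact: mpsi.
  rewrite /mm /= /pushforward -comp_preimage.
  by rewrite (_ : _ \o _ = id)//; apply/funext => z /=; rewrite phiK.
exists m' => F mF F0.
move: (congr1 (@Measure.sort _ _ _) m'E) => /= ->.
by rewrite ge0_integral_pushforward// preimage_setT.
Qed.

Section iterated_tuple_integral.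
Context {R : realType} {d} {Y : measurableType d}.
Variable nu : {sigma_finite_measure set Y -> \bar R}.

Lemma measurable_cons_tuple_pair {d'} {T : measurableType d'} n :
  measurable_fun setT
    (fun z : (T * Y) * n.-tuple Y => (z.1.1, cons_tuple z.1.2 z.2)).
Proof.
apply: measurable_fun_pair.
  by apply: measurableT_comp => //; exact: measurableT_comp.
by apply: (measurable_cons (f := fun z : (T * Y) * n.-tuple Y => z.1.2)) => //;
  apply: measurableT_comp.
Qed.

(** The parameter space varies in the induction, because peeling off the first coordinate moves it
    into the parameter. *)
Lemma measurable_tint n : forall {d'} {T : measurableType d'}
  (F : T * n.-tuple Y -> \bar R), measurable_fun setT F ->
  measurable_fun setT (fun t => tint nu (fun x => F (t, x))).
Proof.
elim: n => [|n IH] d' T F mF /=.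
  exact: (measurableT_comp mF (@measurable_pair2 _ _ T (0.-tuple Y) [tuple])).
apply: (measurable_integral_param nu
  (fun z : T * Y => tint nu (fun x => F (z.1, cons_tuple z.2 x)))).
apply: (IH _ _ (fun z : (T * Y) * n.-tuple Y => F (z.1.1, cons_tuple z.1.2 z.2))).
exact: (measurableT_comp mF (measurable_cons_tuple_pair n)).
Qed.

Lemma eq_tint n (F G : n.-tuple Y -> \bar R) : F =1 G -> tint nu F = tint nu G.
Proof. by move=> /funext ->. Qed.

Lemma tint_ge0 n (F : n.-tuple Y -> \bar R) :
  (forall x, 0 <= F x)%E -> (0 <= tint nu F)%E.
Proof.
elim: n F => [|n IH] F F0 //=.
by apply: integral_ge0 => x _; exact: IH.
Qed.

Lemma measurable_cons_section n (F : n.+1.-tuple Y -> \bar R) :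
  measurable_fun setT F ->
  measurable_fun setT (fun z : Y * n.-tuple Y => F (cons_tuple z.1 z.2)).
Proof. by move=> mF; apply: (measurableT_comp mF); exact: measurable_cons. Qed.

Lemma measurable_tint_cons n (F : n.+1.-tuple Y -> \bar R) :
  measurable_fun setT F ->
  measurable_fun setT (fun x0 => tint nu (fun x => F (cons_tuple x0 x))).
Proof. by move=> /measurable_cons_section/measurable_tint. Qed.

Lemma measurable_cons_fixed n (F : n.+1.-tuple Y -> \bar R) x0 :
  measurable_fun setT F -> measurable_fun setT (fun x => F (cons_tuple x0 x)).
Proof.
move=> /measurable_cons_section mF.
exact: (measurableT_comp mF (measurable_pair1 x0)).
Qed.

Lemma le_tint n (F G : n.-tuple Y -> \bar R) :
  (forall x, 0 <= F x)%E -> measurable_fun setT F -> measurable_fun setT G ->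
  (forall x, F x <= G x)%E -> (tint nu F <= tint nu G)%E.
Proof.
elim: n F G => [|n IH] F G F0 mF mG FG /=; first exact: FG.
apply: ge0_le_integral => //.
- by move=> x _; exact: tint_ge0.
- exact: measurable_tint_cons.
- exact: measurable_tint_cons.
- by move=> x _; apply: IH => //; exact: measurable_cons_fixed.
Qed.

Lemma le_abse_tint n (F : n.-tuple Y -> \bar R) : measurable_fun setT F ->
  (`|tint nu F| <= tint nu (fun x => `|F x|))%E.
Proof.
elim: n F => [|n IH] F mF //=.
apply: (@le_trans _ _ (\int[nu]_x0 `|tint nu (fun x => F (cons_tuple x0 x))|)%E).
  by apply: le_abse_integral => //; exact: measurable_tint_cons.
have mA : measurable_fun setT (fun x => `|F x|)%E by exact: measurableT_comp.
apply: ge0_le_integral => //.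
- by apply: measurableT_comp => //; exact: measurable_tint_cons.
- exact: (measurable_tint_cons _ (fun x => `|F x|)%E mA).
- by move=> x _; apply: IH; exact: measurable_cons_fixed.
Qed.

(** Realizes the iterated integral as a single one, so that the abstract chain can live on
    [Theta * N.-tuple Y]. The measure is built along the bijection between [n.+1]-tuples and pairs
    of a head and an [n]-tuple, starting from a point mass at the empty tuple. *)
Lemma tint_measure_exists n : exists m : {sigma_finite_measure set (n.-tuple Y) -> \bar R},
  forall F : n.-tuple Y -> \bar R, measurable_fun setT F ->
    (forall x, 0 <= F x)%E -> tint nu F = (\int[m]_x F x)%E.
Proof.
elim: n => [|n [m IH]].
  exists (@dirac _ _ [tuple] R) => F mF F0.
  by rewrite integral_dirac// diracT mul1e.
pose phi (z : Y * n.-tuple Y) := cons_tuple z.1 z.2.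
have mphi : measurable_fun setT phi by exact: measurable_cons.
pose psi (x : n.+1.-tuple Y) := (thead x, [tuple of behead x]) : Y * n.-tuple Y.
have mpsi : measurable_fun setT psi.
  by apply: measurable_fun_pair; [exact: measurable_tnth|exact: measurable_behead].
have phiK : cancel phi psi by case=> x t; congr pair; apply/val_inj.
have [nm nmE] := product_measure_exists nu m.
have [m' m'E] := sigma_finite_image_exists nm phi psi mphi mpsi phiK.
exists m' => F mF F0; rewrite m'E// nmE//; last exact: measurable_cons_section.
apply: eq_integral => x _.
by rewrite -IH//; exact: measurable_cons_fixed.
Qed.

End iterated_tuple_integral.

(* Expectation of [phi] under the binomial law with parameters [n] and [h]:
   under [f_theta^n] this is the law of the number of hits [sumw]. *)
Fixpoint Ebin {R : realType} (h : R) (n : nat) (phi : R -> R) : R :=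
  if n is n'.+1
  then h * Ebin h n' (fun j => phi (1 + j)) + (1 - h) * Ebin h n' phi
  else phi 0.

Section binomial_expectation.
Context {R : realType}.
Implicit Types (h : R) (phi psi : R -> R).

(** Although [phi] takes real arguments, to match the real-valued [sumw], it is evaluated at natural
    numbers only. The comparisons further on rely on this: they hold for counts, not for arbitrary
    reals. *)
Lemma eq_Ebin h n phi psi : (forall i : nat, phi i%:R = psi i%:R) ->
  Ebin h n phi = Ebin h n psi.
Proof.
elim: n phi psi => [|n IH] phi psi e /=; first exact: (e 0%N).
by rewrite (IH phi psi)// (IH _ (fun j => psi (1 + j)))// => i; rewrite nat1r e.
Qed.

Lemma Ebin_cst h n c : Ebin h n (fun=> c) = c.
Proof. by elim: n => //= n ->; rewrite -mulrDl addrC subrK mul1r. Qed.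

Lemma EbinD h n phi psi :
  Ebin h n (fun j => phi j + psi j) = Ebin h n phi + Ebin h n psi.
Proof. by elim: n phi psi => //= n IH phi psi; rewrite !IH; ring. Qed.

Lemma EbinZ h n c phi : Ebin h n (fun j => c * phi j) = c * Ebin h n phi.
Proof. by elim: n phi => //= n IH phi; rewrite !IH; ring. Qed.

Lemma le_Ebin h n phi psi : 0 <= h <= 1 ->
  (forall i : nat, phi i%:R <= psi i%:R) -> Ebin h n phi <= Ebin h n psi.
Proof.
move=> /andP[h0 h1]; elim: n phi psi => [|n IH] phi psi le /=; first exact: (le 0%N).
by rewrite lerD// ler_wpM2l ?subr_ge0// IH// => i; rewrite nat1r.
Qed.

Lemma Ebin_exchange h h' n n' (phi : R -> R -> R) :
  Ebin h n (fun i => Ebin h' n' (phi i)) =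
  Ebin h' n' (fun j => Ebin h n (phi ^~ j)).
Proof.
elim: n phi => //= n IH phi.
by rewrite !IH EbinD !EbinZ.
Qed.

(** The factor [j] sums over the [n.+1] draws, which contribute equally; given that one of them is a
    hit, the others are [n] independent draws. *)
Lemma Ebin_size_bias h n phi :
  Ebin h n.+1 (fun j => j * phi j) = n.+1%:R * h * Ebin h n (fun j => phi (1 + j)).
Proof.
elim: n phi => [|n IH] phi; first by rewrite /=; ring.
rewrite [LHS]/=.
rewrite -/(Ebin h n.+1 (fun j => (1 + j) * phi (1 + j))) -/(Ebin h n.+1 (fun j => j * phi j)).
rewrite IH.
(* Splitting [1 + j] exposes a second factor [j], to which the induction hypothesis applies with the
   shifted [phi]. *)
rewrite (eq_Ebin _ _ _ (fun j => phi (1 + j) + j * phi (1 + j))); last first.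
  by move=> j; ring.
rewrite EbinD (IH (fun j => phi (1 + j))) /= -natr1; ring.
Qed.

Lemma Ebin_mean h n : Ebin h n id = n%:R * h.
Proof.
case: n => [|n]; first by rewrite mul0r.
rewrite (eq_Ebin _ _ _ (fun j => j * 1)); last by move=> j; rewrite mulr1.
by rewrite (Ebin_size_bias h n (fun=> 1)) Ebin_cst mulr1.
Qed.

Lemma measurable_Ebin {d} {T : measurableType d} (h : T -> R) n (phi : T -> R -> R) :
  measurable_fun setT h -> (forall j, measurable_fun setT (phi ^~ j)) ->
  measurable_fun setT (fun t => Ebin (h t) n (phi t)).
Proof.
move=> mh; elim: n phi => [|n IH] phi mphi /=; first exact: mphi.
apply: measurable_funD; apply: measurable_funM => //.
- by apply: (IH (fun t j => phi t (1 + j))) => j; exact: mphi.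
- exact: measurable_funB.
- exact: IH.
Qed.

End binomial_expectation.

(** * Tuple integrals as binomial expectations of the hit count *)

Section tuple_likelihood.
Context {R : realType} {dT dY : measure_display}
  {Theta : measurableType dT} {Y : measurableType dY}.
Variables (nu : {sigma_finite_measure set Y -> \bar R}).
Variables (distY : Y -> Y -> R) (y : Y) (eps : R) (f : Theta -> Y -> R).
Hypothesis metY : is_metric distY.
Hypothesis mball_meas : forall r z, measurable (mball distY r z).
Hypothesis fprob : forall theta, prob_density nu (f theta).
Local Notation h := (hfun nu distY y eps f).
Local Notation w := (wfun distY y eps).

Lemma wfunE x : w x = \1_(mball distY eps y) x.
Proof.
have [_ _ distC _] := metY.
by rewrite /wfun !indicE; congr ((nat_of_bool _)%:R); apply/idP/idP; rewrite !inE /mball /= distC.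
Qed.

Lemma hfunE theta : (h theta)%:E = (\int[nu]_(x in mball distY eps y) (f theta x)%:E)%E.
Proof.
have [mf f0 f1] := fprob theta.
rewrite /hfun fineK// ge0_fin_numE; last by apply: integral_ge0 => x _; rewrite lee_fin.
apply: (@le_lt_trans _ _ 1%E); last by rewrite ltry.
rewrite -f1; apply: ge0_subset_integral => //; first exact/measurable_EFinP.
by move=> x _; rewrite lee_fin.
Qed.

Lemma hfun01 theta : 0 <= h theta <= 1.
Proof.
have [mf f0 f1] := fprob theta.
rewrite -!lee_fin hfunE; apply/andP; split.
  by apply: integral_ge0 => x _; rewrite lee_fin.
rewrite -f1; apply: ge0_subset_integral => //; first exact/measurable_EFinP.
by move=> x _; rewrite lee_fin.
Qed.

Lemma prodf_cons n theta x0 (x : n.-tuple Y) :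
  prodf f theta (cons_tuple x0 x) = f theta x0 * prodf f theta x.
Proof.
rewrite /prodf big_ord_recl /= tnth0; congr (_ * _).
by apply: eq_bigr => i _; rewrite tnthS.
Qed.

Lemma sumw_cons n x0 (x : n.-tuple Y) :
  sumw distY y eps (cons_tuple x0 x) = w x0 + sumw distY y eps x.
Proof.
rewrite /sumw big_ord_recl /= tnth0; congr (_ + _).
by apply: eq_bigr => i _; rewrite tnthS.
Qed.

(** Under [f theta] the draws are independent and each hits with probability [h theta], so an
    integrand that sees the tuple only through [sumw] integrates to a finite sum. *)
Lemma tint_prodf_sumw n theta phi :
  tint nu (fun x : n.-tuple Y => (prodf f theta x * phi (sumw distY y eps x))%:E)
  = (Ebin (h theta) n phi)%:E.
Proof.
have [mf f0 f1] := fprob theta.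
elim: n phi => [|n IH] phi; first by rewrite /= /prodf /sumw !big_ord0 mul1r.
rewrite [LHS]/=.
pose A := Ebin (h theta) n (fun j => phi (1 + j)).
pose B := Ebin (h theta) n phi.
have int_f : nu.-integrable setT (fun x => (f theta x)%:E).
  apply/integrableP; split; first exact/measurable_EFinP.
  by under eq_integral do rewrite /= ger0_norm//; rewrite f1 ltry.
pose fb x := ((fun x => (f theta x)%:E) \_ (mball distY eps y)) x.
have int_fb : nu.-integrable setT fb.
  apply/(integrable_mkcond (fun x => (f theta x)%:E) (mball_meas eps y)).
  exact: integrableS int_f.
(* The inner value is [f theta x * A] on a hit and [f theta x * B] otherwise. In this form only the
   masses [h theta] and 1 remain to be integrated, and the signs of [A] and [B] do not matter. *)
transitivity (\int[nu]_x ((A - B)%:E * fb x + B%:E * (f theta x)%:E))%E.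
  apply: eq_integral => x _.
  under eq_tint => t do rewrite prodf_cons sumw_cons -mulrA mulrCA.
  rewrite (IH (fun j => f theta x * phi (w x + j))) EbinZ.
  rewrite wfunE indicE /fb patchE; case: ifP => _ /=.
    by rewrite -/A -!EFinM -EFinD; congr EFin; ring.
  rewrite (eq_Ebin _ _ _ phi); last by move=> j; rewrite add0r.
  by rewrite mule0 add0e -EFinM mulrC.
rewrite integralD//; try exact: integrableZl.
rewrite !integralZl// f1 mule1 -integral_mkcond -hfunE -EFinM -EFinD.
by congr EFin; rewrite /A /B /=; ring.
Qed.

End tuple_likelihood.

(** * The two ABC kernels *)

(** Real powers invert nonnegative bases, hence the detour through [x ^+ 2]; at 0 both sides
    vanish. *)
Lemma measurable_invr {R : realType} : measurable_fun setT (@GRing.inv R).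
Proof.
rewrite (_ : @GRing.inv R = fun x => x * (x ^+ 2) `^ (-1)).
  apply: measurable_funM => //.
  by apply: (measurableT_comp (measurable_powR (-1))); exact: measurable_funX.
apply/funext => x; rewrite powR_inv1 ?sqr_ge0//.
by have [->|x0] := eqVneq x 0; rewrite ?invr0 ?mul0r// expr2 invfM mulrA divff// mul1r.
Qed.

Lemma measurable_funV {R : realType} {d} {T : measurableType d} (g : T -> R) :
  measurable_fun setT g -> measurable_fun setT (fun x => (g x)^-1).
Proof. by move=> mg; exact: (measurableT_comp measurable_invr). Qed.

Lemma abse_fine_le {R : realType} (x : \bar R) : (`|fine x|%:E <= `|x|)%E.
Proof. by case: x => [r||] //=; rewrite normr0 leey. Qed.

(** [I] is the jump integral and [a] the acceptance. If [I] is infinite, [fine] sends it to 0 but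
    [J] is then [+oo], so the bound survives. *)
Lemma abse_jump_le {R : realType} (I J a : \bar R) (u : R) :
  (`|I| <= J -> 0 <= a <= 1 ->
   `|(fine I + (1 - fine a) * u - u)%R|%:E <= J + a * `|u|%:E)%E.
Proof.
move=> IJ /andP[a0 a1].
have af : a \is a fin_num by rewrite ge0_fin_numE// (le_lt_trans a1)// ltry.
rewrite (_ : (_ + _ - u)%R = (fine I - fine a * u)%R); last by ring.
apply: (@le_trans _ _ (`|fine I|%:E + a * `|u|%:E)%E); last first.
  by rewrite leeD2r// (le_trans (abse_fine_le I)).
rewrite -[in leRHS](fineK af) -EFinM -EFinD lee_fin.
by rewrite (le_trans (ler_normB _ _))// normrM (ger0_norm (fine_ge0 a0)).
Qed.

(* For [a = 0] the division gives [b / 0 = 0], which keeps the identity true. *)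
Lemma mulr_min1_div {R : realType} (a b : R) : 0 <= a -> 0 <= b ->
  a * Num.min 1 (b / a) = Num.min a b.
Proof.
move=> a0 b0; have [->|an0] := eqVneq a 0; first by rewrite mul0r min_l.
by rewrite minr_pMr// mulr1 mulrC divfK.
Qed.

Section abc.
Context {R : realType} {dT dY : measure_display}
  {Theta : measurableType dT} {Y : measurableType dY}.
Variables (mu : {sigma_finite_measure set Theta -> \bar R}).
Variables (nu : {sigma_finite_measure set Y -> \bar R}).
Variables (distT : Theta -> Theta -> R) (distY : Y -> Y -> R).
Variables (y : Y) (eps : R) (p : Theta -> R) (f : Theta -> Y -> R).
Variables (q : Theta -> Theta -> R) (theta0 : Theta).
Hypothesis metT : is_metric distT.
Hypothesis metY : is_metric distY.
Hypothesis mballT : forall r z, measurable (mball distT r z).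
Hypothesis mballY : forall r z, measurable (mball distY r z).
Hypothesis mp : measurable_fun setT p.
Hypothesis p0 : forall theta, 0 <= p theta.
Hypothesis mf : measurable_fun setT (fun tx : Theta * Y => f tx.1 tx.2).
Hypothesis fprob : forall theta, prob_density nu (f theta).
Hypothesis mq : measurable_fun setT (fun tt : Theta * Theta => q tt.1 tt.2).
Hypothesis qprob : forall theta, prob_density mu (q theta).
Hypothesis Hbnd : (0 < Hconst mu nu distY y eps p f < +oo)%E.
Hypothesis tight : forall delta : R, 0 < delta -> exists r : R, 0 < r /\
  forall theta, (\int[mu]_(vt in ~` mball distT r theta) (q theta vt)%:E < delta%:E)%E.
Hypothesis mass : forall r : R, 0 < r ->
  (0 < \int[mu]_(theta in ~` mball distT r theta0)
         (pidens mu nu distY y eps p f theta)%:E)%E.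
Hypothesis hvan : (fun v : R => sup [set hfun nu distY y eps f theta |
                       theta in ~` mball distT v theta0]) @ +oo --> (0 : R).

Local Notation h := (hfun nu distY y eps f).
Local Notation c := (cfun p q).
Local Notation sw := (sumw distY y eps).
Local Notation pi := (pidens mu nu distY y eps p f).
Local Notation H := (fine (Hconst mu nu distY y eps p f)).
Let A n := ~` mball distT n.+1%:R theta0.

Lemma measurable_hfun : measurable_fun setT h.
Proof.
apply/measurable_EFinP.
rewrite (_ : _ \o _ = fun theta => \int[nu]_x (f theta x * \1_(mball distY eps y) x)%:E)%E.
  apply: (measurable_integral_param nu
    (fun z : Theta * Y => (f z.1 z.2 * \1_(mball distY eps y) z.2)%:E)).
  by apply/measurable_EFinP/measurable_funM => //; exact: measurableT_comp.
apply/funext => theta /=; rewrite hfunE// integral_mkcond.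
apply: eq_integral => x _; rewrite patchE indicE.
by case: ifP; rewrite ?mulr1 ?mulr0.
Qed.

Lemma Hconst_gt0 : 0 < H.
Proof. by case/andP: Hbnd => H0 Hoo; rewrite fine_gt0// H0. Qed.

Lemma HconstE : (H%:E = Hconst mu nu distY y eps p f)%E.
Proof. by case/andP: Hbnd => H0 Hoo; rewrite fineK// ge0_fin_numE// ltW. Qed.

Lemma h01 theta : 0 <= h theta <= 1.
Proof. exact: hfun01. Qed.

Lemma h_ge0 theta : 0 <= h theta.
Proof. by case/andP: (h01 theta). Qed.

Lemma q_ge0 theta vt : 0 <= q theta vt.
Proof. by have [_ + _] := qprob theta; apply. Qed.

Lemma cfun_ge0 theta vt : 0 <= c theta vt.
Proof. by rewrite mulr_ge0// q_ge0. Qed.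

Lemma measurable_pidens : measurable_fun setT pi.
Proof.
apply: measurable_funM => //; apply: measurable_funM => //.
exact: measurable_hfun.
Qed.

Lemma pidens_ge0 theta : 0 <= pi theta.
Proof. by rewrite divr_ge0 ?(ltW Hconst_gt0)// mulr_ge0// h_ge0. Qed.

Lemma integral_pidens : (\int[mu]_theta (pi theta)%:E = 1)%E.
Proof.
under eq_integral do rewrite /pidens mulrC EFinM.
rewrite ge0_integralZl_EFin//.
- by rewrite -/(Hconst mu nu distY y eps p f) -HconstE -EFinM mulVf// gt_eqF// Hconst_gt0.
- by move=> theta _; rewrite lee_fin mulr_ge0// h_ge0.
- by apply/measurable_EFinP/measurable_funM => //; exact: measurable_hfun.
- by rewrite invr_ge0 ltW// Hconst_gt0.
Qed.

Lemma measurable_far n : measurable (A n).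
Proof. exact: measurableC. Qed.

Lemma far_vanishes theta : \forall n \near \oo, ~ A n theta.
Proof.
exists (Num.truncn (distT theta0 theta)) => // n /= tn; apply; rewrite /mball /=.
by apply: lt_le_trans (truncnS_gt _) _; rewrite ler_nat.
Qed.

Lemma far_mass_gt0 n : (0 < \int[mu]_(theta in A n) (pi theta)%:E)%E.
Proof. exact: mass. Qed.

Lemma near_h_far_le (e : R) : 0 < e ->
  exists v : R, forall theta, v <= distT theta0 theta -> h theta <= e.
Proof.
move=> e0; have /cvgrPdist_lt/(_ _ e0)[M [_ HM]] := hvan.
exists (M + 1) => theta; rewrite leNgt => /negP far.
have /HM : M < M + 1 by rewrite ltrDl.
rewrite sub0r normrN => /ltW; apply: le_trans; apply: le_trans (ler_norm _).
(* The values of [h] are bounded by 1, so [sup] is a genuine upper bound. *)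
apply: ub_le_sup; last by exists theta.
by exists 1 => _ [vt _ <-]; case/andP: (h01 vt).
Qed.

(** Proposals longer than [r] have mass below [e / 2] by tightness. Shorter ones that start beyond
    [v + r] land beyond [v], where [N * h] is at most [e / 2]. *)
Lemma low_acceptance_far (N : nat) (e : R) : 0 < e ->
  \forall n \near \oo, forall theta, A n theta ->
    (\int[mu]_vt (q theta vt * Num.min 1 (N%:R * h vt))%:E <= e%:E)%E.
Proof.
move=> e0; have e20 : 0 < e / 2 by rewrite divr_gt0.
have [r [r0 qr]] := tight _ e20.
(* [N.+1] rather than [N] keeps the tolerance positive when [N = 0]. *)
have [|v hv] := near_h_far_le (e / 2 / N.+1%:R); first by rewrite divr_gt0.
near=> n => theta; rewrite /A /mball /= => /negP; rewrite -leNgt => far.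
have [mqt q0 q1] := qprob theta.
have vr : v + r <= n.+1%:R.
  near: n; exists (Num.truncn (v + r)) => // n /= tn.
  by apply: le_trans (ltW (truncnS_gt _)) _; rewrite ler_nat.
apply: (@le_trans _ _ (\int[mu]_vt (((fun x => (q theta x)%:E) \_ (~` mball distT r theta)) vt
    + (e / 2)%:E * (q theta vt)%:E))%E).
  apply: ge0_le_integral => //.
  - by move=> vt _; rewrite lee_fin mulr_ge0// le_min ler01 mulr_ge0// h_ge0.
  - apply/measurable_EFinP/measurable_funM => //.
    by apply: measurable_minr => //; apply: measurable_funM => //; exact: measurable_hfun.
  - apply: emeasurable_funD.
      apply/(measurable_restrictT _ (measurableC (mballT r theta))).
      by apply: measurable_funTS; exact/measurable_EFinP.
    by apply/measurable_EFinP/measurable_funM.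
  move=> vt _; rewrite patchE; case: ifPn => [_|].
    rewrite -EFinM -EFinD lee_fin -[leLHS]addr0 lerD//; last by rewrite mulr_ge0// ltW.
    by rewrite -[leRHS]mulr1 ler_wpM2l// ge_min lexx.
  rewrite notin_setE /mball /= => /contrapT near_vt.
  rewrite add0e -EFinM lee_fin mulrC ler_wpM2r// ge_min; apply/orP; right.
  apply: (@le_trans _ _ (N%:R * (e / 2 / N.+1%:R))).
    apply: ler_wpM2l => //; apply: hv.
    have [_ _ _ tri] := metT.
    have := tri theta0 vt theta; have [_ _ distC _] := metT.
    rewrite (distC vt theta); lra.
  by rewrite mulrCA ger_pMr// ler_pdivrMr// mul1r ler_nat.
rewrite ge0_integralD//.
- rewrite -integral_mkcond ge0_integralZl_EFin//; last 3 first.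
  + by move=> x _; rewrite lee_fin.
  + exact/measurable_EFinP.
  + exact: ltW.
  by rewrite q1 mule1 [e in leRHS]splitr EFinD leeD2r// ltW.
- by move=> x _; rewrite patchE; case: ifP => //= _; rewrite lee_fin.
- apply/(measurable_restrictT _ (measurableC (mballT r theta))).
  by apply: measurable_funTS; exact/measurable_EFinP.
- by move=> x _; rewrite -EFinM lee_fin mulr_ge0// ltW.
- by apply/measurable_EFinP/measurable_funM.
Unshelve. all: by end_near.
Qed.

(** * The marginal chain on the parameter space *)

Lemma alpha2E n theta vt : alpha2 nu distY y eps p f q n.+1 theta vt =
  Ebin (h vt) n.+1 (fun j => Ebin (h theta) n
    (fun i => Num.min 1 (c vt theta * j / (c theta vt * (1 + i))))).
Proof.
pose Phi j i := Num.min 1 (c vt theta * j / (c theta vt * (1 + i))).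
rewrite /alpha2.
transitivity (fine (tint nu (fun z : n.+1.-tuple Y =>
    (prodf f vt z * Ebin (h theta) n (Phi (sw z)))%:E))); last first.
  by rewrite (tint_prodf_sumw nu distY y eps f metY mballY fprob n.+1 vt
    (fun j => Ebin (h theta) n (Phi j))).
congr fine; apply: eq_tint => z.
rewrite -EbinZ -(tint_prodf_sumw nu distY y eps f metY mballY fprob n theta
  (fun i => prodf f vt z * Phi (sw z) i)).
by apply: eq_tint => x; rewrite /Phi; congr EFin; ring.
Qed.

Let k2 n theta vt := q theta vt * alpha2 nu distY y eps p f q n.+1 theta vt.

Lemma alpha2_ge0 n theta vt : 0 <= alpha2 nu distY y eps p f q n.+1 theta vt.
Proof.
rewrite alpha2E -(Ebin_cst (h vt) n.+1 0); apply: le_Ebin => [|j]; first exact: h01.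
rewrite -(Ebin_cst (h theta) n 0); apply: le_Ebin => [|i]; first exact: h01.
by rewrite le_min ler01 divr_ge0// mulr_ge0 ?cfun_ge0// addr_ge0.
Qed.

(** Without a hit at [vt] the ratio is 0, and with [j >= 1] hits the acceptance is at most [1 <= j];
    the mean of [j] is [n.+1 * h vt]. *)
Lemma alpha2_le n theta vt :
  alpha2 nu distY y eps p f q n.+1 theta vt <= Num.min 1 (n.+1%:R * h vt).
Proof.
rewrite alpha2E le_min -Ebin_mean; apply/andP; split.
  rewrite -[leRHS](Ebin_cst (h vt) n.+1); apply: le_Ebin => [|j]; first exact: h01.
  rewrite -[leRHS](Ebin_cst (h theta) n); apply: le_Ebin => [|i]; first exact: h01.
  by rewrite ge_min lexx.
apply: le_Ebin => [|j]; first exact: h01.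
rewrite -[leRHS](Ebin_cst (h theta) n); apply: le_Ebin => [|i]; first exact: h01.
case: j => [|j]; first by rewrite mulr0 mul0r ge_min lexx orbT.
by rewrite ge_min ler1n.
Qed.

(* The size-bias identity turns the factor [h theta], together with the forced
   hit [1 + _] in the denominator of [alpha2], into a sum over all [n.+1] draws,
   which makes the weight symmetric. *)
Lemma alpha2_detailed_balance n theta vt :
  pi theta * k2 n theta vt = pi vt * k2 n vt theta.
Proof.
have weight s t : p s * h s * k2 n s t * n.+1%:R =
    Ebin (h t) n.+1 (fun j => Ebin (h s) n.+1 (fun i =>
      Num.min (c s t * i) (c t s * j))).
  rewrite /k2 alpha2E.
  rewrite (_ : p s * h s * (q s t * _) * _ =
    c s t * (n.+1%:R * h s) * Ebin (h t) n.+1 (fun j => Ebin (h s) n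
      (fun i => Num.min 1 (c t s * j / (c s t * (1 + i)))))); last first.
    by rewrite /cfun; ring.
  rewrite -EbinZ; apply: eq_Ebin => j.
  rewrite -mulrA -(Ebin_size_bias _ _ (fun i => Num.min 1 (c t s * j%:R / (c s t * i)))).
  rewrite -EbinZ; apply: eq_Ebin => i.
  by rewrite mulrA mulr_min1_div// mulr_ge0// cfun_ge0.
rewrite /pidens mulrAC [RHS]mulrAC; congr (_ / _).
apply: (@mulIf _ n.+1%:R); first by rewrite pnatr_eq0.
rewrite !weight Ebin_exchange.
by apply: eq_Ebin => j; apply: eq_Ebin => i; rewrite minC.
Qed.

Lemma measurable_k2 n : measurable_fun setT (fun tt : Theta * Theta => k2 n tt.1 tt.2).
Proof.
have mh1 : measurable_fun setT (fun tt : Theta * Theta => h tt.1).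
  by apply: measurableT_comp => //; exact: measurable_hfun.
have mh2 : measurable_fun setT (fun tt : Theta * Theta => h tt.2).
  by apply: measurableT_comp => //; exact: measurable_hfun.
have mc1 : measurable_fun setT (fun tt : Theta * Theta => c tt.1 tt.2).
  by apply: measurable_funM => //; exact: measurableT_comp.
have mc2 : measurable_fun setT (fun tt : Theta * Theta => c tt.2 tt.1).
  exact: (measurableT_comp mc1 (@measurable_swap _ _ Theta Theta)).
apply: measurable_funM => //.
rewrite (_ : (fun tt => _) = fun tt : Theta * Theta => Ebin (h tt.2) n.+1
    (fun j => Ebin (h tt.1) n (fun i =>
       Num.min 1 (c tt.2 tt.1 * j / (c tt.1 tt.2 * (1 + i)))))); last first.
  by apply/funext => tt; rewrite alpha2E.
apply: measurable_Ebin => // j; apply: measurable_Ebin => // i.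
apply: measurable_minr => //; apply: measurable_funM; first exact: measurable_funM.
by apply: measurable_funV; exact: measurable_funM.
Qed.

Lemma P2_not_variance_bounding n :
  ~ variance_bounding (Epi mu nu distY y eps p f) (P2 mu nu distY y eps p f q n.+1).
Proof.
have mk := measurable_k2 n.
have mk1 theta : measurable_fun setT (k2 n theta) by exact: measurable_uncurry_r mk.
have k0 theta vt : 0 <= k2 n theta vt by rewrite mulr_ge0 ?q_ge0 ?alpha2_ge0.
have kle theta vt : k2 n theta vt <= q theta vt * Num.min 1 (n.+1%:R * h vt).
  by rewrite ler_wpM2l ?q_ge0 ?alpha2_le.
have k_le1 theta : (\int[mu]_vt (k2 n theta vt)%:E <= 1)%E.
  have [mqt q0 q1] := qprob theta; rewrite -q1.
  apply: ge0_le_integral => //.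
  - by move=> vt _; rewrite lee_fin.
  - exact/measurable_EFinP.
  - exact/measurable_EFinP.
  move=> vt _; rewrite lee_fin; apply: le_trans (kle _ _) _.
  by rewrite -[leRHS]mulr1 ler_wpM2l// ge_min lexx.
apply: (@not_variance_bounding_of_low_acceptance _ _ _ _ _ mu mu pi (k2 n) id pi _ _ A) => //.
- exact: measurable_pidens.
- exact: pidens_ge0.
- exact: alpha2_detailed_balance.
- exact: measurable_pidens.
- exact: pidens_ge0.
- exact: integral_pidens.
- move=> u mu'; rewrite /P2.
  have ku : measurable_fun setT (fun tt : Theta * Theta => (k2 n tt.1 tt.2 * u tt.2)%:E).
    by apply/measurable_EFinP/measurable_funM => //; exact: measurableT_comp.
  have kk : measurable_fun setT (fun tt : Theta * Theta => (k2 n tt.1 tt.2)%:E).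
    exact/measurable_EFinP.
  apply: measurable_funD.
    by apply: measurableT_comp; [exact: fine_measurable|exact: (measurable_integral_param mu _ ku)].
  apply: measurable_funM => //; apply: measurable_funB => //.
  by apply: measurableT_comp; [exact: fine_measurable|exact: (measurable_integral_param mu _ kk)].
- move=> u theta mu'.
  have mku : measurable_fun setT (fun vt => (k2 n theta vt * u vt)%:E).
    exact/measurable_EFinP/measurable_funM.
  apply: abse_jump_le.
    apply: le_trans (le_abse_integral _ measurableT mku) _.
    rewrite le_eqVlt; apply/orP; left; apply/eqP; apply: eq_integral => vt _.
    by rewrite abse_EFin normrM (ger0_norm (k0 _ _)).
  apply/andP; split; last exact: k_le1.
  by apply: integral_ge0 => vt _; rewrite lee_fin; exact: k0.
- exact: measurable_far.
- exact: far_vanishes.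
- exact: far_mass_gt0.
- move=> e e0; have := low_acceptance_far n.+1 e e0.
  apply: filterS => i low theta /low; apply: le_trans.
  apply: ge0_le_integral => //.
  + by move=> vt _; rewrite lee_fin.
  + exact/measurable_EFinP.
  + apply/measurable_EFinP/measurable_funM; first by have [] := qprob theta.
    by apply: measurable_minr => //; apply: measurable_funM => //; exact: measurable_hfun.
  by move=> vt _; rewrite lee_fin.
Qed.

(** * The chain on the extended space of parameters and draws *)

Section pseudo_marginal.
Variable N : nat.
Hypothesis N_gt0 : (0 < N)%N.
Local Notation S := (Theta * N.-tuple Y)%type.
Local Notation Z := (fine (Zbar mu nu distY y eps p f N)).
Local Notation acc := (acc1 distY y eps p q).

Let rho (s : S) := pibar_un distY y eps p f s.1 s.2 / Z.
Let k1 (s t : S) := q s.1 t.1 * prodf f t.1 t.2 * acc s.1 s.2 t.1 t.2.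

Lemma sumw_natural n (x : n.-tuple Y) : exists i : nat, sw x = i%:R.
Proof.
exists (\sum_(j < n) (y \in mball distY eps (tnth x j)))%N.
by rewrite natr_sum.
Qed.

Lemma sumw_ge0 n (x : n.-tuple Y) : 0 <= sw x.
Proof. by have [i ->] := sumw_natural _ x. Qed.

Lemma prodf_ge0 n theta (x : n.-tuple Y) : 0 <= prodf f theta x.
Proof. by apply: prodr_ge0 => j _; have [_ + _] := fprob theta; apply. Qed.

(** The averaged weight [sumw / N] has mean [h theta]. Hence the parameter marginal of the extended
    target is [pi], and both targets have the same normalizing constant. *)
Lemma tint_pibar (theta : Theta) (a : R) :
  tint nu (fun x : N.-tuple Y => (a * pibar_un distY y eps p f theta x)%:E)
  = (a * (p theta * h theta))%:E.
Proof.
transitivity (tint nu (fun x : N.-tuple Y =>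
    (prodf f theta x * (fun j => a * p theta / N%:R * j) (sw x))%:E)).
  by apply: eq_tint => x; rewrite /pibar_un; congr EFin; ring.
rewrite tint_prodf_sumw// EbinZ Ebin_mean; congr EFin.
by field; rewrite pnatr_eq0 -lt0n.
Qed.

Lemma ZbarE : Zbar mu nu distY y eps p f N = Hconst mu nu distY y eps p f.
Proof.
apply: eq_integral => theta _; rewrite -[RHS]mul1e -EFinM -tint_pibar.
by apply: eq_tint => x; rewrite mul1r.
Qed.

Lemma Z_gt0 : 0 < Z.
Proof. by rewrite ZbarE Hconst_gt0. Qed.

Lemma pibar_un_ge0 theta (x : N.-tuple Y) : 0 <= pibar_un distY y eps p f theta x.
Proof. by rewrite mulr_ge0 ?divr_ge0 ?sumw_ge0// mulr_ge0// prodf_ge0. Qed.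

Lemma acc1_ge0 theta (x : N.-tuple Y) vt z : 0 <= acc theta x vt z.
Proof.
by rewrite le_min ler01 divr_ge0// mulr_ge0 ?cfun_ge0 ?sumw_ge0.
Qed.

(** [sw z] is a count: either it is 0 and so is the ratio, or it is at least 1. *)
Lemma acc1_le theta (x : N.-tuple Y) vt z : acc theta x vt z <= Num.min 1 (sw z).
Proof.
rewrite le_min ge_min lexx /= /acc1.
have [[|i] ->] := sumw_natural _ z; first by rewrite mulr0 mul0r ge_min lexx orbT.
by rewrite ge_min ler1n.
Qed.

Lemma measurable_sumw n : measurable_fun setT (fun x : n.-tuple Y => sw x).
Proof.
apply: measurable_sum => i.
rewrite (_ : (fun x => _) = (\1_(mball distY eps y) : Y -> R) \o (@tnth _ _ ^~ i)).
  apply: measurableT_comp => //; exact: measurable_tnth.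
by apply/funext => x /=; rewrite wfunE.
Qed.

Lemma measurable_prodf n :
  measurable_fun setT (fun s : Theta * n.-tuple Y => prodf f s.1 s.2).
Proof.
apply: measurable_prod => i _.
apply: (measurableT_comp mf (g := fun s : Theta * n.-tuple Y => (s.1, tnth s.2 i))).
apply: measurable_fun_pair => //.
exact: (measurableT_comp (measurable_tnth i)).
Qed.

(** The factor [sumw] of the target cancels the denominator of the acceptance ratio, leaving a
    minimum of two terms that exchanging the states swaps. *)
Lemma pibar_detailed_balance s t : rho s * k1 s t = rho t * k1 t s.
Proof.
have weight (a b : S) : pibar_un distY y eps p f a.1 a.2 * k1 a b =
    prodf f a.1 a.2 * prodf f b.1 b.2 / N%:R
    * Num.min (c a.1 b.1 * sw a.2) (c b.1 a.1 * sw b.2).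
  rewrite -mulr_min1_div; try by rewrite mulr_ge0 ?cfun_ge0 ?sumw_ge0.
  by rewrite /pibar_un /k1 /acc1 /cfun; ring.
rewrite /rho mulrAC [RHS]mulrAC !weight minC; congr (_ * _ * _ / _).
by rewrite mulrC.
Qed.

Lemma measurable_rho : measurable_fun setT rho.
Proof.
apply: measurable_funM => //; apply: measurable_funM.
  apply: measurable_funM; first exact: measurableT_comp.
  exact: measurable_prodf.
apply: measurable_funM => //.
exact: (measurableT_comp (measurable_sumw N)).
Qed.

Lemma measurable_k1 : measurable_fun setT (fun st : S * S => k1 st.1 st.2).
Proof.
have m1 : measurable_fun setT (fun st : S * S => st.1.1) by exact: measurableT_comp.
have m2 : measurable_fun setT (fun st : S * S => st.2.1) by exact: measurableT_comp.
have mc1 : measurable_fun setT (fun st : S * S => c st.1.1 st.2.1).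
  apply: measurable_funM; first exact: (measurableT_comp mp m1).
  exact: (measurableT_comp mq (measurable_fun_pair m1 m2)).
have mc2 : measurable_fun setT (fun st : S * S => c st.2.1 st.1.1).
  apply: measurable_funM; first exact: (measurableT_comp mp m2).
  exact: (measurableT_comp mq (measurable_fun_pair m2 m1)).
apply: measurable_funM.
  apply: measurable_funM.
    exact: (measurableT_comp mq (measurable_fun_pair m1 m2)).
  exact: (measurableT_comp (measurable_prodf N)).
have ms1 : measurable_fun setT (fun st : S * S => sw st.1.2).
  by apply: (measurableT_comp (measurable_sumw N)); exact: measurableT_comp.
have ms2 : measurable_fun setT (fun st : S * S => sw st.2.2).
  by apply: (measurableT_comp (measurable_sumw N)); exact: measurableT_comp.
apply: measurable_minr => //; apply: measurable_funM; first exact: measurable_funM.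
by apply: measurable_funV; exact: measurable_funM.
Qed.

Lemma P1_not_variance_bounding :
  ~ variance_bounding (Ebar mu nu distY y eps p f (N:=N))
                      (P1 mu nu distY y eps p f q (N:=N)).
Proof.
have mk := measurable_k1.
have mks s : measurable_fun setT (k1 s) by exact: measurable_uncurry_r mk.
have k0 s t : 0 <= k1 s t by rewrite !mulr_ge0 ?q_ge0 ?prodf_ge0 ?acc1_ge0.
have [mN mNE] := tint_measure_exists nu N.
have [m mE] := product_measure_exists mu mN.
have int_m (F : S -> \bar R) : measurable_fun setT F -> (forall s, 0 <= F s)%E ->
    (\int[m]_s F s = \int[mu]_theta tint nu (fun x => F (theta, x)))%E.
  move=> mF F0; rewrite mE//; apply: eq_integral => theta _.
  by rewrite mNE//; exact: (measurableT_comp mF (measurable_pair1 theta)).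
(* Integrating out the fresh draws turns [min(1, sw z)] into a binomial expectation, bounded both by
   1 and by the mean [N * h vt]. *)
have acceptance s : (\int[m]_t (k1 s t)%:E <=
    \int[mu]_vt (q s.1 vt * Num.min 1 (N%:R * h vt))%:E)%E.
  have mks' : measurable_fun setT (fun t => (k1 s t)%:E) by exact/measurable_EFinP.
  rewrite int_m//; last by move=> t; rewrite lee_fin.
  have bound vt : (tint nu (fun z => (k1 s (vt, z))%:E) <=
      (q s.1 vt * Ebin (h vt) N (Num.min 1))%:E)%E.
    rewrite -EbinZ -(tint_prodf_sumw _ _ _ _ _ metY mballY fprob).
    apply: le_tint.
    - by move=> z; rewrite lee_fin.
    - exact: (measurableT_comp mks' (measurable_pair1 vt)).
    - apply/measurable_EFinP/measurable_funM.
        exact: measurable_uncurry_r (measurable_prodf N).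
      apply: measurable_funM => //; apply: measurable_minr => //.
      exact: measurable_sumw.
    move=> z; rewrite lee_fin /k1 /= mulrA [prodf _ _ _ * _]mulrC.
    by rewrite ler_wpM2l ?acc1_le// mulr_ge0 ?q_ge0 ?prodf_ge0.
  apply: ge0_le_integral => //.
  - by move=> vt _; apply: tint_ge0 => z; rewrite lee_fin.
  - exact: measurable_tint mks'.
  - apply/measurable_EFinP/measurable_funM; first by have [] := qprob s.1.
    by apply: measurable_minr => //; apply: measurable_funM => //; exact: measurable_hfun.
  move=> vt _; apply: le_trans (bound vt) _.
  rewrite lee_fin ler_wpM2l ?q_ge0// le_min; apply/andP; split.
    rewrite -[leRHS](Ebin_cst (h vt) N); apply: le_Ebin => [|j]; first exact: h01.
    by rewrite ge_min lexx.
  rewrite -Ebin_mean; apply: le_Ebin => [|j]; first exact: h01.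
  by rewrite ge_min lexx orbT.
have k_le1 s : (\int[m]_t (k1 s t)%:E <= 1)%E.
  have [mqs q0 q1] := qprob s.1; rewrite -q1; apply: le_trans (acceptance s) _.
  apply: ge0_le_integral => //.
  - by move=> vt _; rewrite lee_fin mulr_ge0// le_min ler01 mulr_ge0// h_ge0.
  - apply/measurable_EFinP/measurable_funM => //.
    by apply: measurable_minr => //; apply: measurable_funM => //; exact: measurable_hfun.
  - exact/measurable_EFinP.
  by move=> vt _; rewrite lee_fin -[leRHS]mulr1 ler_wpM2l// ge_min lexx.
apply: (@not_variance_bounding_of_low_acceptance _ _ _ _ _ m mu rho k1 fst pi _ _ A) => //.
- exact: measurable_rho.
- by move=> s; rewrite divr_ge0 ?pibar_un_ge0// ltW// Z_gt0.
- exact: pibar_detailed_balance.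
- exact: measurable_pidens.
- exact: pidens_ge0.
- exact: integral_pidens.
- move=> u mu' u0; rewrite int_m//.
    by apply/measurable_EFinP/measurable_funM => //; exact: measurable_rho.
  by move=> s; rewrite lee_fin mulr_ge0// divr_ge0 ?pibar_un_ge0// ltW// Z_gt0.
- move=> v mv; apply: eq_integral => theta _ /=.
  transitivity (tint nu (fun x : N.-tuple Y =>
      (v theta / Z * pibar_un distY y eps p f theta x)%:E)).
    by apply: eq_tint => x; congr EFin; rewrite mulrA mulrAC.
  rewrite tint_pibar ZbarE /pidens -!mulrA; congr (_ * _)%:E.
  by rewrite [LHS]mulrC -mulrA.
- move=> u mu'.
  have ku : measurable_fun setT (fun st : S * S => (k1 st.1 st.2 * u st.2)%:E).
    by apply/measurable_EFinP/measurable_funM => //; exact: measurableT_comp.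
  have kk : measurable_fun setT (fun st : S * S => (k1 st.1 st.2)%:E).
    exact/measurable_EFinP.
  have outer (F : S * S -> \bar R) : measurable_fun setT F ->
      measurable_fun setT (fun s => fine (\int[mu]_vt tint nu (fun z => F (s, (vt, z))))%E).
    move=> mF; apply: measurableT_comp; first exact: fine_measurable.
    apply: (measurable_integral_param mu
      (fun sv : S * Theta => tint nu (fun z => F (sv.1, (sv.2, z))))).
    apply: (measurable_tint nu N (fun r : (S * Theta) * N.-tuple Y => F (r.1.1, (r.1.2, r.2)))).
    apply: (measurableT_comp mF).
    apply: measurable_fun_pair; first exact: measurableT_comp.
    by apply: measurable_fun_pair => //; exact: measurableT_comp.
  rewrite (_ : P1 _ _ _ _ _ _ _ _ u = fun s =>
      fine (\int[mu]_vt tint nu (fun z => (k1 s (vt, z) * u (vt, z))%:E))%E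
      + (1 - fine (\int[mu]_vt tint nu (fun z => (k1 s (vt, z))%:E))%E) * u s); last first.
    by apply/funext => -[theta x].
  apply: measurable_funD; first exact: (outer _ ku).
  by apply: measurable_funM => //; apply: measurable_funB => //; exact: (outer _ kk).
- move=> u [theta x] mu'.
  have mku : measurable_fun setT (fun t => (k1 (theta, x) t * u t)%:E).
    exact/measurable_EFinP/measurable_funM.
  have mku' : measurable_fun setT (fun t => (k1 (theta, x) t * `|u t|)%:E).
    by apply/measurable_EFinP/measurable_funM => //; exact: measurableT_comp.
  have mks' : measurable_fun setT (fun t => (k1 (theta, x) t)%:E) by exact/measurable_EFinP.
  (* [int_m] identifies single and iterated integrals for nonnegative integrands. For the signed
     integrand [k1 * u], absolute values are first moved inside the iterated integral. *)
  rewrite [X in (_ <= _ + X * _)%E]int_m//; last by move=> t; rewrite lee_fin.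
  apply: abse_jump_le.
    rewrite int_m//; last by move=> t; rewrite lee_fin mulr_ge0.
    have mt := measurable_tint nu N _ mku.
    apply: le_trans (le_abse_integral _ measurableT mt) _.
    apply: ge0_le_integral => //.
    - exact: measurableT_comp.
    - exact: (measurable_tint nu N _ mku').
    move=> vt _.
    have mkv := measurableT_comp mku (measurable_pair1 vt).
    apply: le_trans (le_abse_tint nu _ _ mkv) _.
    rewrite le_eqVlt; apply/orP; left; apply/eqP; apply: eq_tint => z /=.
    by rewrite normrM (ger0_norm (k0 _ _)).
  apply/andP; split.
    by apply: integral_ge0 => vt _; apply: tint_ge0 => z; rewrite lee_fin; exact: (k0 (theta, x) (vt, z)).
  have := k_le1 (theta, x); rewrite int_m//.
  by move=> t; rewrite lee_fin.
- exact: measurable_far.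
- exact: far_vanishes.
- exact: far_mass_gt0.
- move=> e e0; have := low_acceptance_far N e e0.
  apply: filterS => i low s /low; exact: le_trans.
Qed.

End pseudo_marginal.

End abc.

Theorem theorem2 (R : realType) (dT dY : measure_display)
  (Theta : measurableType dT) (Y : measurableType dY)
  (mu : {measure set Theta -> \bar R}) (nu : {measure set Y -> \bar R})
  (distT : Theta -> Theta -> R) (distY : Y -> Y -> R)
  (y : Y) (eps : R) (p : Theta -> R) (f : Theta -> Y -> R)
  (q : Theta -> Theta -> R) (theta0 : Theta) :
  (* standing assumptions *)
  sigma_finite setT mu -> sigma_finite setT nu ->
  is_metric distT -> is_metric distY ->
  (forall r z, measurable (mball distT r z)) ->
  (forall r z, measurable (mball distY r z)) ->
  0 < eps ->
  measurable_fun setT p -> (forall theta, 0 <= p theta) ->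
  measurable_fun setT (fun tx : Theta * Y => f tx.1 tx.2) ->
  (forall theta, prob_density nu (f theta)) ->
  measurable_fun setT (fun tt : Theta * Theta => q tt.1 tt.2) ->
  (forall theta, prob_density mu (q theta)) ->
  (0 < Hconst mu nu distY y eps p f < +oo)%E ->
  (* Condition 1 *)
  (forall delta : R, 0 < delta -> exists r : R, 0 < r /\
     forall theta, (\int[mu]_(vt in ~` mball distT r theta) (q theta vt)%:E
                     < delta%:E)%E) ->
  (forall r : R, 0 < r ->
     (0 < \int[mu]_(theta in ~` mball distT r theta0)
            (pidens mu nu distY y eps p f theta)%:E)%E) ->
  (fun v : R => sup [set hfun nu distY y eps f theta |
                       theta in ~` mball distT v theta0]) @ +oo --> (0 : R) ->
  (* conclusion *)
  forall N : nat, (0 < N)%N ->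
    ~ variance_bounding (Ebar mu nu distY y eps p f (N:=N))
                        (P1 mu nu distY y eps p f q (N:=N)) /\
    ~ variance_bounding (Epi mu nu distY y eps p f)
                        (P2 mu nu distY y eps p f q N).

Proof.
(* Replaces both measures by bundled sigma-finite ones, the form that Tonelli takes. *)
move=> smu snu; have [mu' <-] := sigma_finite_measure_exists mu smu.
have [nu' <-] := sigma_finite_measure_exists nu snu.
move=> metT metY mballT mballY _ mp p0 mf fprob mq qprob Hbnd tight mass hvan N N0.
split.
  by apply: (P1_not_variance_bounding mu' nu' distT distY y eps p f q theta0).
case: N N0 => // n _.
by apply: (P2_not_variance_bounding mu' nu' distT distY y eps p f q theta0).
Qed.
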